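(* Let $D=(V,A)$ be a finite digraph (possibly with multiple arcs), let $\lambda\colon A\to\mathbb{R}_+$, let $r\in V$, and let $T_1$ and $T_2$ be two time-respecting $r$-arborescences of $D$ for $\lambda$. Then there is a reconfiguration sequence between $T_1$ and $T_2$, all of whose members are time-respecting $r$-arborescences of $D$, of length $|A(T_1)\setminus A(T_2)|$. Moreover, such a reconfiguration sequence can be found in polynomial time (given $D,\lambda,r,T_1,T_2$).
   Context: $\mathbb{R}_+$ is the set of non-negative reals. For a digraph $H$, $A(H)$ denotes its arc set. An $r$-arborescence in $D$ is a spanning acyclic subgraph of $D$ in which there is exactly one directed path from $r$ to every vertex. A directed path traversing arcs $e_1,\dots,e_k$ in this order is time-respecting for $\lambda$ if $\lambda(e_i)\le\lambda(e_{i+1})$ for $1\le i<k$. An $r$-arborescence is time-respecting if every directed path in it is time-respecting. A reconfiguration sequence between $T_1$ and $T_2$ is a sequence $(T^0,T^1,\dots,T^\ell)$ of arborescences in $D$ with $T^0=T_1$, $T^\ell=T_2$ and $|A(T^i)\setminus A(T^{i+1})|=|A(T^{i+1})\setminus A(T^i)|=1$ for $0\le i<\ell$; its length is $\ell$. For the running-time claim, labels are given in a standard finite encoding (e.g. as non-negative rationals). *)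

(* Defs.v *)
From Corelib Require Import BinNums.
From mathcomp Require Import all_boot all_order all_algebra.
From mathcomp Require Import reals.

Set Implicit Arguments.
Unset Strict Implicit.
Unset Printing Implicit Defensive.

Import Order.TTheory GRing.Theory Num.Theory.

(* Arcs form a type of their own, so parallel arcs and loops are allowed. *)
Record digraph := Digraph {
  vertices : finType;
  arcs : finType;
  source : arcs -> vertices;
  target : arcs -> vertices
}.

Section Arborescences.
Variable D : digraph.
Implicit Types (T : {set arcs D}) (x y r : vertices D) (s : seq (arcs D)).

Fixpoint diwalk x s y : bool :=
  if s is a :: s' then (source a == x) && diwalk (target a) s' y else x == y.

(* The empty sequence is a path from every vertex to itself. *)
Definition dipath T x s y : bool :=
  [&& all (fun a => a \in T) s, diwalk x s y & uniq (x :: map (@target D) s)].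

Definition dicycle T x s : bool :=
  [&& s != [::], all (fun a => a \in T) s, diwalk x s x
    & uniq (map (@target D) s)].

(* A spanning subgraph has all the vertices of D, so it is given by its set of
   arcs T. *)
Definition is_arborescence r T : Prop :=
  (forall x s, ~~ dicycle T x s) /\
  (forall x, exists! s, dipath T r s x).

Section Labels.
Variables (R : numDomainType) (lambda : arcs D -> R).

Definition time_respecting_path s : bool :=
  sorted (fun a b => (lambda a <= lambda b)%R) s.

Definition is_tr_arborescence r T : Prop :=
  is_arborescence r T /\
  (forall x s y, dipath T x s y -> time_respecting_path s).

End Labels.

Definition exchange T T' : bool :=
  (#|T :\: T'| == 1) && (#|T' :\: T| == 1).

(* Ts lists T^0, ..., T^l; its length as a reconfiguration sequence is the
   number l of exchanges, not the number l + 1 of arborescences. *)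
Definition reconfiguration_seq T1 T2 (Ts : seq {set arcs D}) : Prop :=
  [/\ forall T, T \in Ts -> exists r, is_arborescence r T,
      ohead Ts = Some T1, last T1 Ts = T2 & sorted exchange Ts].

Definition reconfiguration_length (Ts : seq {set arcs D}) : nat :=
  (size Ts).-1.

End Arborescences.

(* A first-order functional language over binary trees, with a call-by-value
   cost semantics.  Programs are closed finite objects: a list of function
   bodies (mutually recursive, one argument each), function 0 being the entry
   point.  Variables are de Bruijn indices. *)

Inductive tree := Leaf | Node (t u : tree).

Fixpoint tree_size (t : tree) : nat :=
  if t is Node t1 t2 then (tree_size t1 + tree_size t2).+1 else 1.

Inductive expr :=
  | EVar (i : nat)
  | ELeaf
  | ENode (e1 e2 : expr)
  | ELet (e1 e2 : expr)
  | ECase (e e1 e2 : expr)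
  | ECall (f : nat) (e : expr).

Definition program := seq expr.

(* [eval P env e v c]: in environment env, e evaluates to v at cost c.
   Reading a variable copies its value and is charged the size of that value;
   every other step is charged 1.  Nothing is shared, so the size of a value is
   at most the cost of computing it (eval_size), and a run of cost c on an input
   of size n is simulated by a Turing machine in time polynomial in n + c;
   conversely a Turing machine is simulated with polynomial overhead.  Hence
   polynomial cost in this model is polynomial time in the usual sense. *)
Inductive eval (P : program) : seq tree -> expr -> tree -> nat -> Prop :=
  | EvalVar env i :
      eval P env (EVar i) (nth Leaf env i) (tree_size (nth Leaf env i))
  | EvalLeaf env : eval P env ELeaf Leaf 1
  | EvalNode env e1 e2 v1 v2 c1 c2 :
      eval P env e1 v1 c1 -> eval P env e2 v2 c2 ->
      eval P env (ENode e1 e2) (Node v1 v2) (c1 + c2).+1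
  | EvalLet env e1 e2 v1 v2 c1 c2 :
      eval P env e1 v1 c1 -> eval P (v1 :: env) e2 v2 c2 ->
      eval P env (ELet e1 e2) v2 (c1 + c2).+1
  | EvalCaseLeaf env e e1 e2 v c c1 :
      eval P env e Leaf c -> eval P env e1 v c1 ->
      eval P env (ECase e e1 e2) v (c + c1).+1
  | EvalCaseNode env e e1 e2 t u v c c2 :
      eval P env e (Node t u) c -> eval P (t :: u :: env) e2 v c2 ->
      eval P env (ECase e e1 e2) v (c + c2).+1
  | EvalCall env f e v1 v c1 c2 :
      eval P env e v1 c1 -> eval P [:: v1] (nth ELeaf P f) v c2 ->
      eval P env (ECall f e) v (c1 + c2).+1.

Lemma eval_det P env e v c v' c' :
  eval P env e v c -> eval P env e v' c' -> v = v' /\ c = c'.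
Proof.
move=> H; elim: H v' c' => {env e v c}; intros;
  (match goal with H : eval _ _ _ _ _ |- _ => inversion H; subst end) => //;
  repeat match goal with
  | IH : forall v' c', eval ?P ?env ?e v' c' -> _, H : eval ?P ?env ?e _ _ |- _ =>
      destruct (IH _ _ H) as [E ?]; clear IH H; try discriminate E;
      try injection E as ? ?; subst
  end; done.
Qed.

Lemma eval_size P env e v c : eval P env e v c -> tree_size v <= c.
Proof.
elim=> //=.
- by move=> *; rewrite ltnS leq_add.
- by move=> _ _ _ v1 v2 c1 c2 _ _ _ /leq_trans-> //; rewrite leqW ?leq_addl.
- by move=> _ _ _ _ v' c' c1 _ _ _ /leq_trans-> //; rewrite leqW ?leq_addl.
- by move=> _ _ _ _ t u v' c' c2 _ _ _ /leq_trans-> //; rewrite leqW ?leq_addl.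
- by move=> _ _ _ v1 v' c1 c2 _ _ _ /leq_trans-> //; rewrite leqW ?leq_addl.
Qed.

Definition run (P : program) (x y : tree) (c : nat) : Prop :=
  eval P [:: x] (nth ELeaf P 0) y c.

Definition enc_bool (b : bool) : tree := if b then Node Leaf Leaf else Leaf.

Definition enc_seq (X : Type) (enc : X -> tree) (s : seq X) : tree :=
  foldr (fun x t => Node (enc x) t) Leaf s.

Fixpoint bits_of_pos (p : positive) : seq bool :=
  match p with
  | xH => [:: true]
  | xO q => false :: bits_of_pos q
  | xI q => true :: bits_of_pos q
  end.

(* Binary notation, least significant bit first; 0 is the empty list. *)
Definition enc_nat (n : nat) : tree :=
  enc_seq enc_bool (if bin_of_nat n is Npos p then bits_of_pos p else [::]).

(* Meant for q >= 0: the sign of the numerator is dropped. *)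
Definition enc_nonneg_rat (q : rat) : tree :=
  Node (enc_nat `|numq q|%N) (enc_nat `|denq q|%N).

Section EncodeDigraph.
Variable D : digraph.

Definition enc_vertex (x : vertices D) : tree := enc_nat (enum_rank x).

(* Incidence vector of T, in the order in which enc_instance lists the arcs. *)
Definition enc_arc_set (T : {set arcs D}) : tree :=
  enc_seq (fun a => enc_bool (a \in T)) (enum (arcs D)).

Definition enc_arc (lambda : arcs D -> rat) (a : arcs D) : tree :=
  Node (enc_vertex (source a))
       (Node (enc_vertex (target a)) (enc_nonneg_rat (lambda a))).

Definition enc_instance (lambda : arcs D -> rat) (r : vertices D)
    (T1 T2 : {set arcs D}) : tree :=
  Node (enc_seq enc_vertex (enum (vertices D)))
       (Node (enc_seq (enc_arc lambda) (enum (arcs D)))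
             (Node (enc_vertex r) (Node (enc_arc_set T1) (enc_arc_set T2)))).

Definition enc_reconfiguration (Ts : seq {set arcs D}) : tree :=
  enc_seq enc_arc_set Ts.

End EncodeDigraph.

(* Main.v *)
Require Import Defs.
From mathcomp Require Import all_boot all_order all_algebra.
From mathcomp Require Import reals.
From mathcomp Require Import zify.

Set Implicit Arguments.
Unset Strict Implicit.
Unset Printing Implicit Defensive.

Import Order.TTheory GRing.Theory Num.Theory.

(** Let T* be the arborescence in which every vertex is entered by the cheaper
    of its arcs in T1 and T2, ties going to T1.  Starting from T1, go through
    the vertices in an order in which parents in T2 come first, and exchange the
    arc entering v for the one of T2 whenever the latter is strictly cheaper;
    this ends in T*.  Starting from T2, go through the vertices in an order in
    which parents in T1 come first, and exchange the arc entering v for the one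
    of T1 whenever the latter is different and not more expensive; this ends in
    T* as well.  The first sequence followed by the reverse of the second one
    exchanges every arc of T1 not in T2 exactly once.  Every intermediate set is
    a time-respecting arborescence: the label of the arc entering a vertex never
    decreases from parent to child, and a path along which it is constant changes
    at most once from arcs of T1 to arcs of T2 and never back, so there is no
    cycle.

    For the running time, functions computable in polynomial time on encoded
    data are closed under composition, pairing, case distinction, and recursion
    on lists with polynomially bounded intermediate values; the labels are
    compared by cross-multiplication of binary numbers. *)

(** * Polynomial-time functions *)

(** The base [n.+2] is at least 2 even for [n = 0], so constants and sums are absorbed by raising
    the exponent. *)
Definition poly_bounded (h : nat -> nat) := exists k, forall n, h n <= n.+2 ^ k.

Lemma leq_powS m n k : m <= n -> m.+2 ^ k <= n.+2 ^ k.
Proof. by case: k => [|k] le_mn //; rewrite leq_exp2r. Qed.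

Lemma poly_bounded_id : poly_bounded id.
Proof. by exists 1 => n; rewrite expn1; lia. Qed.

Lemma poly_bounded_const c : poly_bounded (fun=> c).
Proof.
by exists c => n; apply: leq_trans (ltnW (ltn_expl c (isT : 1 < 2))) (leq_powS _ _).
Qed.

Lemma poly_boundedD h1 h2 :
  poly_bounded h1 -> poly_bounded h2 -> poly_bounded (fun n => h1 n + h2 n).
Proof.
move=> [k1 b1] [k2 b2]; exists (maxn k1 k2).+1 => n; rewrite expnS.
have le1 : n.+2 ^ k1 <= n.+2 ^ maxn k1 k2 by rewrite leq_exp2l ?leq_maxl.
have le2 : n.+2 ^ k2 <= n.+2 ^ maxn k1 k2 by rewrite leq_exp2l ?leq_maxr.
by move: (b1 n) (b2 n); nia.
Qed.

Lemma poly_boundedM h1 h2 :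
  poly_bounded h1 -> poly_bounded h2 -> poly_bounded (fun n => h1 n * h2 n).
Proof.
by move=> [k1 b1] [k2 b2]; exists (k1 + k2) => n; rewrite expnD leq_mul.
Qed.

Lemma poly_bounded_comp h1 h2 :
  poly_bounded h1 -> poly_bounded h2 -> poly_bounded (fun n => h1 (h2 n)).
Proof.
(* Two extra factors of [n.+2] turn the bound on [h2 n] into one on [(h2 n).+2]. *)
move=> [k1 b1] [k2 b2]; exists (k2.+2 * k1) => n.
apply: leq_trans (b1 _) _; rewrite expnM.
case: k1 {b1} => [|k1] //; rewrite leq_exp2r // !expnS.
have := b2 n; have : 0 < n.+2 ^ k2 by rewrite expn_gt0.
nia.
Qed.

Ltac poly_bounded :=
  repeat first [ exact: poly_bounded_id | exact: poly_bounded_const | assumption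
    | apply: poly_boundedD | apply: poly_boundedM
    | match goal with H : poly_bounded ?h |- poly_bounded (fun n => ?h _) =>
        apply: (poly_bounded_comp H) end ].

(** * Types with an encoding as trees, and the sizes of encodings *)

Structure encType := EncType { enc_sort :> Type; enc : enc_sort -> tree }.

Arguments enc : simpl never.
Arguments tree_size : simpl never.

Canonical bool_encType := EncType enc_bool.
Canonical prod_encType (X Y : encType) :=
  EncType (fun p : X * Y => Node (enc p.1) (enc p.2)).
Canonical seq_encType (X : encType) := EncType (enc_seq (@enc X)).

Notation esize x := (tree_size (enc x)).

Lemma esize_gt0 (X : encType) (x : X) : 0 < esize x.
Proof. by case: (enc x). Qed.

Lemma esize_pair (X Y : encType) (x : X) (y : Y) :
  esize (x, y) = (esize x + esize y).+1.
Proof. by []. Qed.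

Lemma esize_nil (X : encType) : esize ([::] : seq X) = 1.
Proof. by []. Qed.

Lemma esize_cons (X : encType) (x : X) (s : seq X) :
  esize (x :: s) = (esize x + esize s).+1.
Proof. by []. Qed.

Lemma esize_bool (b : bool) : esize b <= 3.
Proof. by case: b. Qed.

Lemma esize_cat (X : encType) (s1 s2 : seq X) :
  (esize (s1 ++ s2)).+1 = esize s1 + esize s2.
Proof. by elim: s1 => [|x s IH] /=; rewrite ?esize_cons ?esize_nil; lia. Qed.

Lemma size_leq_esize (X : encType) (s : seq X) : size s < esize s.
Proof. by elim: s => [|x s IH] //; rewrite esize_cons /=; lia. Qed.

Lemma esize_bits (s : seq bool) : esize s <= (4 * size s).+1.
Proof. by elim: s => [|x s IH] //; rewrite esize_cons /=; move: (esize_bool x); lia. Qed.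

Definition loaded (P : program) b (ds : seq expr) :=
  forall i, i < size ds -> nth ELeaf P (b + i) = nth ELeaf ds i.

Lemma loaded_catl P b d1 d2 : loaded P b (d1 ++ d2) -> loaded P b d1.
Proof.
by move=> ld i lti; rewrite ld ?nth_cat ?lti // size_cat ltn_addr.
Qed.

Lemma loaded_catr P b d1 d2 : loaded P b (d1 ++ d2) -> loaded P (b + size d1) d2.
Proof.
move=> ld i lti; rewrite -addnA ld ?size_cat ?ltn_add2l // nth_cat.
by rewrite ltnNge leq_addr addKn.
Qed.

(* The auxiliary functions [ds] may be placed at any address [b] of any
   program, so that implementations can be combined by concatenation. *)
Definition ptime (X Y : encType) (f : X -> Y) :=
  exists (e : nat -> expr) (ds : nat -> seq expr) (h : nat -> nat),
    [/\ poly_bounded h, {homo h : m n / m <= n}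
      & forall P b, loaded P b (ds b) -> forall x env,
        exists2 c, eval P (enc x :: env) (e b) (enc (f x)) c & c <= h (esize x)].

(** Monotonicity of the cost bound comes for free, since the bound may be replaced by a power of
    [n.+2]. *)
Lemma ptimeI (X Y : encType) (f : X -> Y)
    (e : nat -> expr) (ds : nat -> seq expr) (h : nat -> nat) :
  poly_bounded h ->
  (forall P b, loaded P b (ds b) -> forall x env,
     exists2 c, eval P (enc x :: env) (e b) (enc (f x)) c & c <= h (esize x)) ->
  ptime f.
Proof.
move=> [k hk] he; exists e, ds, (fun n => n.+2 ^ k); split.
- by exists k.
- by move=> m n; apply: leq_powS.
by move=> P b ld x env; have [c ev le_c] := he P b ld x env; exists c => //;
  apply: leq_trans (hk _).
Qed.

(** A value is at most as large as the cost of computing it, so a cost bound also bounds the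
    output. *)
Lemma ptime_size (X Y : encType) (f : X -> Y) :
  ptime f -> exists h, [/\ poly_bounded h, {homo h : m n / m <= n}
                         & forall x, esize (f x) <= h (esize x)].
Proof.
move=> [e [ds [h [pb hm he]]]]; exists h; split=> // x.
have ld : loaded (nseq 0 ELeaf ++ ds 0) 0 (ds 0) by move=> i.
by have [c /eval_size] := he _ _ ld x [::]; apply: leq_trans.
Qed.

Lemma eval_var P env i v :
  v = nth Leaf env i -> eval P env (EVar i) v (tree_size v).
Proof. by move->; exact: EvalVar. Qed.

(** * Composition, pairing, projections and case distinction *)

Section Combinators.
Variables X Y Z : encType.

Lemma ptime_id : ptime (fun x : X => x).
Proof.
apply: (@ptimeI _ _ _ (fun=> EVar 0) (fun=> [::]) id poly_bounded_id).
by move=> P b _ x env; eexists; first exact: eval_var.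
Qed.

(** The auxiliary code of [g] is placed behind that of [f]. Its cost is bounded in the size of
    [f x], hence in that of [x] because [h2] is monotone. *)
Lemma ptime_comp (f : X -> Y) (g : Y -> Z) :
  ptime f -> ptime g -> ptime (fun x => g (f x)).
Proof.
move=> [e1 [d1 [h1 [p1 m1 he1]]]] [e2 [d2 [h2 [p2 m2 he2]]]].
apply: (@ptimeI _ _ _ (fun b => ELet (e1 b) (e2 (b + size (d1 b))))
  (fun b => d1 b ++ d2 (b + size (d1 b))) (fun n => h1 n + h2 (h1 n) + 1)).
  by poly_bounded.
move=> P b ld x env.
have [c1 ev1 le1] := he1 P b (loaded_catl ld) x env.
have [c2 ev2 le2] := he2 P _ (loaded_catr ld) (f x) (enc x :: env).
exists (c1 + c2).+1; first exact: EvalLet ev1 ev2.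
have := m2 _ _ (leq_trans (eval_size ev1) le1); lia.
Qed.

Lemma ptime_pair (f : X -> Y) (g : X -> Z) :
  ptime f -> ptime g -> ptime (fun x => (f x, g x)).
Proof.
move=> [e1 [d1 [h1 [p1 m1 he1]]]] [e2 [d2 [h2 [p2 m2 he2]]]].
apply: (@ptimeI _ _ _ (fun b => ENode (e1 b) (e2 (b + size (d1 b))))
  (fun b => d1 b ++ d2 (b + size (d1 b))) (fun n => h1 n + h2 n + 1)).
  by poly_bounded.
move=> P b ld x env.
have [c1 ev1 le1] := he1 P b (loaded_catl ld) x env.
have [c2 ev2 le2] := he2 P _ (loaded_catr ld) x env.
exists (c1 + c2).+1; [exact: EvalNode ev1 ev2 | lia].
Qed.

Lemma ptime_cons (f : X -> Y) (g : X -> seq Y) :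
  ptime f -> ptime g -> ptime (fun x => f x :: g x).
Proof.
move=> [e1 [d1 [h1 [p1 m1 he1]]]] [e2 [d2 [h2 [p2 m2 he2]]]].
apply: (@ptimeI _ _ _ (fun b => ENode (e1 b) (e2 (b + size (d1 b))))
  (fun b => d1 b ++ d2 (b + size (d1 b))) (fun n => h1 n + h2 n + 1)).
  by poly_bounded.
move=> P b ld x env.
have [c1 ev1 le1] := he1 P b (loaded_catl ld) x env.
have [c2 ev2 le2] := he2 P _ (loaded_catr ld) x env.
exists (c1 + c2).+1; [exact: EvalNode ev1 ev2 | lia].
Qed.

Lemma ptime_fst (f : X -> Y * Z) : ptime f -> ptime (fun x => (f x).1).
Proof.
move=> [e1 [d1 [h1 [p1 m1 he1]]]].
apply: (@ptimeI _ _ _ (fun b => ECase (e1 b) ELeaf (EVar 0)) d1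
  (fun n => h1 n + h1 n + 1)); first by poly_bounded.
move=> P b ld x env; have [c1 ev1 le1] := he1 P b ld x env.
case: (f x) ev1 => y w ev1.
eexists; first by apply: EvalCaseNode ev1 _; apply: eval_var.
have := leq_trans (eval_size ev1) le1; rewrite esize_pair /=; lia.
Qed.

Lemma ptime_snd (f : X -> Y * Z) : ptime f -> ptime (fun x => (f x).2).
Proof.
move=> [e1 [d1 [h1 [p1 m1 he1]]]].
apply: (@ptimeI _ _ _ (fun b => ECase (e1 b) ELeaf (EVar 1)) d1
  (fun n => h1 n + h1 n + 1)); first by poly_bounded.
move=> P b ld x env; have [c1 ev1 le1] := he1 P b ld x env.
case: (f x) ev1 => y w ev1.
eexists; first by apply: EvalCaseNode ev1 _; apply: eval_var.
have := leq_trans (eval_size ev1) le1; rewrite esize_pair /=; lia.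
Qed.

Lemma ptime_leaf (y : Y) : enc y = Leaf -> ptime (fun _ : X => y).
Proof.
move=> y0.
apply: (@ptimeI _ _ _ (fun=> ELeaf) (fun=> [::]) (fun=> 1)).
  by poly_bounded.
by move=> P b _ x env; exists 1; rewrite ?y0 //; exact: EvalLeaf.
Qed.

(** On the empty list the code returns [ELeaf], so the default value must be encoded by [Leaf]. *)
Lemma ptime_head (y : Y) (f : X -> seq Y) :
  enc y = Leaf -> ptime f -> ptime (fun x => head y (f x)).
Proof.
move=> y0 [e1 [d1 [h1 [p1 m1 he1]]]].
apply: (@ptimeI _ _ _ (fun b => ECase (e1 b) ELeaf (EVar 0)) d1
  (fun n => h1 n + h1 n + 2)); first by poly_bounded.
move=> P b ld x env; have [c1 ev1 le1] := he1 P b ld x env.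
case: (f x) ev1 => [|a s] ev1.
  exists (c1 + 1).+1; last lia.
  by apply: EvalCaseLeaf ev1 _; rewrite /= y0; exact: EvalLeaf.
eexists; first by apply: EvalCaseNode ev1 _; apply: eval_var.
have := leq_trans (eval_size ev1) le1; rewrite esize_cons /=; lia.
Qed.

Lemma ptime_behead (f : X -> seq Y) : ptime f -> ptime (fun x => behead (f x)).
Proof.
move=> [e1 [d1 [h1 [p1 m1 he1]]]].
apply: (@ptimeI _ _ _ (fun b => ECase (e1 b) ELeaf (EVar 1)) d1
  (fun n => h1 n + h1 n + 2)); first by poly_bounded.
move=> P b ld x env; have [c1 ev1 le1] := he1 P b ld x env.
case: (f x) ev1 => [|a s] ev1.
  exists (c1 + 1).+1; last lia.
  by apply: EvalCaseLeaf ev1 _; exact: EvalLeaf.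
eexists; first by apply: EvalCaseNode ev1 _; apply: eval_var.
have := leq_trans (eval_size ev1) le1; rewrite esize_cons /=.
lia.
Qed.

Lemma ptime_if (b : X -> bool) (f g : X -> Y) :
  ptime b -> ptime f -> ptime g -> ptime (fun x => if b x then f x else g x).
Proof.
move=> [e1 [d1 [h1 [p1 m1 he1]]]] [e2 [d2 [h2 [p2 m2 he2]]]].
move=> [e3 [d3 [h3 [p3 m3 he3]]]].
pose b2 i := i + size (d1 i); pose b3 i := b2 i + size (d2 (b2 i)).
(* The node branch binds two more variables; the [ELet] brings the input, then at index 2, back to
   index 0. *)
apply: (@ptimeI _ _ _
  (fun i => ECase (e1 i) (e3 (b3 i)) (ELet (EVar 2) (e2 (b2 i))))
  (fun i => d1 i ++ d2 (b2 i) ++ d3 (b3 i))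
  (fun n => h1 n + (n + h2 n) + h3 n + 2)); first by poly_bounded.
move=> P i ld x env.
have [c1 ev1 le1] := he1 P i (loaded_catl ld) x env.
have ld' := loaded_catr ld.
case: (b x) ev1 => ev1.
  have [c2 ev2 le2] := he2 P _ (loaded_catl ld') x [:: Leaf, Leaf, enc x & env].
  eexists; first by apply: EvalCaseNode ev1 _; apply: EvalLet ev2; apply: eval_var.
  by rewrite /=; lia.
have [c3 ev3 le3] := he3 P _ (loaded_catr ld') x env.
by exists (c1 + c3).+1; [exact: EvalCaseLeaf ev1 ev3 | lia].
Qed.

End Combinators.

Arguments ptime_id {X}.

(** * Recursion on lists *)

Section Recursion.
Variables St Y A : encType.
Variables (z : St -> A) (g : St * Y -> St) (f : St * Y * A -> A).

(** The state travels down the list through [g], the value comes back up through [f]; both [foldl]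
    and [foldr] are special cases. *)
Fixpoint state_rec s l :=
  if l is y :: l' then f (s, y, state_rec (g (s, y)) l') else z s.

(** If all states and all values stay polynomially small, every level of the recursion has
    polynomial cost outside the recursive call, and the number of levels is at most the size of the
    input. *)
Lemma ptime_state_rec (hs ha : nat -> nat) :
  ptime z -> ptime g -> ptime f -> poly_bounded hs -> poly_bounded ha ->
  (forall s l, esize (foldl (fun s y => g (s, y)) s l) <= hs (esize (s, l))) ->
  (forall s l, esize (state_rec s l) <= ha (esize (s, l))) ->
  ptime (fun p => state_rec p.1 p.2).
Proof.
move=> [e1 [d1 [h1 [p1 m1 he1]]]] [e2 [d2 [h2 [p2 m2 he2]]]].
move=> [e3 [d3 [h3 [p3 m3 he3]]]] [ks hks] [ka hka] bs ba.
pose b1 i := i.+1; pose b2 i := b1 i + size (d1 (b1 i)).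
pose b3 i := b2 i + size (d2 (b2 i)).
(* The argument is a pair of a state [s] and a list. On a nonempty list the environment starts with
   the head [y], the tail and [s]; the successive [ELet] bind the pair [(s, y)], the value for the
   tail, and the argument of [f]. *)
pose body i := ECase (EVar 0) ELeaf (ECase (EVar 1) (e1 (b1 i))
  (ELet (ENode (EVar 2) (EVar 0))
  (ELet (ECall i (ENode (e2 (b2 i)) (EVar 2)))
  (ELet (ENode (EVar 1) (EVar 0)) (e3 (b3 i)))))).
pose step M := h1 M + h2 (M + M + 1) + h3 (M + M + M + M + 2) + 10 * M + 20.
pose pw k n := n.+2 ^ k; have ppw k : poly_bounded (pw k) by exists k.
(* This bounds each state paired with the rest of the list, and each value on the way back; [step]
   of it bounds the cost of one level. *)
pose bnd n := pw ks n + n + pw ka (pw ks n + n + 1).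
have pbnd : poly_bounded bnd.
  rewrite /bnd; poly_bounded; first exact: ppw.
  by apply: (poly_bounded_comp (ppw _)); poly_bounded; exact: ppw.
have pstep : poly_bounded (fun n => step (bnd n)) by rewrite /step; poly_bounded.
apply: (@ptimeI _ _ _ (fun i => ECall i (EVar 0))
  (fun i => body i :: d1 (b1 i) ++ d2 (b2 i) ++ d3 (b3 i))
  (fun n => n * step (bnd n) + n + 1)); first by poly_bounded.
move=> P i ld [s0 l0] env.
have ldP : nth ELeaf P i = body i by have := ld 0 isT; rewrite addn0.
have ld' : loaded P (b1 i) (d1 (b1 i) ++ d2 (b2 i) ++ d3 (b3 i)).
  by move=> j lt_j; have := ld j.+1 lt_j; rewrite addnS.
have ld1 := loaded_catl ld'; have ld2 := loaded_catl (loaded_catr ld').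
have ld3 := loaded_catr (loaded_catr ld').
set n0 := esize (s0, l0); set M := bnd n0.
have def_n0 : n0 = (esize s0 + esize l0).+1 by exact: esize_pair.
have main : forall l1 l, l0 = l1 ++ l -> exists2 c,
    eval P [:: enc (foldl (fun s y => g (s, y)) s0 l1, l)] (body i)
      (enc (state_rec (foldl (fun s y => g (s, y)) s0 l1) l)) c
    & c <= (size l).+1 * step M; last first.
  have [c ev le_c] := main [::] l0 erefl.
  exists (tree_size (enc (s0, l0)) + c).+1.
    by apply: EvalCall; [exact: eval_var | rewrite ldP].
  have le_n : (size l0).+1 <= n0.
    have := size_leq_esize l0. lia.
  have := leq_mul le_n (leqnn (step M)); rewrite -/n0 -/M; lia.
have le_st : forall l1 l2, l0 = l1 ++ l2 ->
    let s := foldl (fun s y => g (s, y)) s0 l1 in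
    esize (s, l2) <= M /\ esize (state_rec s l2) <= M.
  move=> l1 l2 def_l s.
  have le_l : esize l1 <= esize l0 /\ esize l2 <= esize l0.
    have := esize_cat l1 l2; rewrite -def_l.
    by have := esize_gt0 l1; have := esize_gt0 l2; lia.
  have le_s : esize s <= pw ks n0.
    apply: leq_trans (bs s0 l1) (leq_trans (hks _) (leq_powS _ _)).
    by rewrite esize_pair def_n0; lia.
  have le_p : esize (s, l2) <= pw ks n0 + n0 + 1 by rewrite esize_pair; lia.
  have le_a : esize (state_rec s l2) <= pw ka (pw ks n0 + n0 + 1).
    by apply: leq_trans (ba s l2) (leq_trans (hka _) (leq_powS _ le_p)).
  have pw_gt0 : 0 < pw ka (pw ks n0 + n0 + 1) by rewrite expn_gt0.
  have defM : M = pw ks n0 + n0 + pw ka (pw ks n0 + n0 + 1) by [].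
  by split; lia.
move=> l1 l; elim: l l1 => [|y l IH] l1 def_l.
  have [le_p _] := le_st _ _ def_l; set s := foldl _ s0 l1 in le_p *.
  have [c1 ev1 le1] := he1 _ _ ld1 s [:: enc ([::] : seq Y); enc (s, [::] : seq Y)].
  eexists.
    apply: (@EvalCaseNode _ _ _ _ _ (enc s) (enc ([::] : seq Y))).
      exact: eval_var.
    by apply: EvalCaseLeaf ev1; apply: eval_var.
  move: le_p; rewrite esize_pair esize_nil /= mul1n /step => le_p.
   have := m1 (esize s) M; lia.
have [le_p le_a] := le_st _ _ def_l.
have def_l' : l0 = rcons l1 y ++ l by rewrite cat_rcons.
have [le_p' le_a'] := le_st _ _ def_l'.
move: IH => /(_ _ def_l') [c ev le_c].
move: le_p' le_a' ev; rewrite foldl_rcons.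
set s := foldl _ s0 l1 in le_p le_a * => le_p' le_a' ev.
have [c2 ev2 le2] := he2 _ _ ld2 (s, y)
  [:: enc y; enc l; enc s; enc (y :: l); enc (s, y :: l)].
have [c3 ev3 le3] := he3 _ _ ld3 (s, y, state_rec (g (s, y)) l)
  [:: enc (state_rec (g (s, y)) l); enc (s, y); enc y; enc l; enc s;
      enc (y :: l); enc (s, y :: l)].
eexists.
  apply: (@EvalCaseNode _ _ _ _ _ (enc s) (enc (y :: l))); first exact: eval_var.
  apply: (@EvalCaseNode _ _ _ _ _ (enc y) (enc l)); first exact: eval_var.
  apply: EvalLet; first by apply: EvalNode; exact: eval_var.
  apply: EvalLet.
    apply: EvalCall; last by rewrite ldP; exact: ev.
    by apply: EvalNode ev2 _; exact: eval_var.
  apply: EvalLet ev3.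
  by apply: EvalNode; exact: eval_var.
move: le_p le_p' le2 le3; rewrite !esize_pair /= => le_p le_p' le2 le3.
have := m2 (esize s + esize y).+1 (M + M + 1).
have := m3 ((esize s + esize y).+1 + esize (state_rec (g (s, y)) l)).+1 (M + M + M + M + 2).
rewrite (mulSn (size l).+1) {1}/step; lia.
Qed.

End Recursion.

Lemma ptime_ext (X Y : encType) (f g : X -> Y) : f =1 g -> ptime f -> ptime g.
Proof.
move=> fg [e [ds [h [pb hm he]]]]; exists e, ds, h; split=> // P b ld x env.
by rewrite -fg; exact: he.
Qed.

Section Foldr.
Variables (X Y A : encType) (F : X -> Y -> A -> A) (Z : X -> A) (l : X -> seq Y).
Hypotheses (ptime_l : ptime l) (ptime_Z : ptime Z).
Hypothesis ptime_F : ptime (fun p : X * Y * A => F p.1.1 p.1.2 p.2).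

(** A recursion whose state is the parameter [x], passed on unchanged. *)
Lemma ptime_foldr (h : nat -> nat) :
  poly_bounded h ->
  (forall x s, esize (foldr (F x) (Z x) s) <= h (esize x + esize s)) ->
  ptime (fun x => foldr (F x) (Z x) (l x)).
Proof.
move=> [k hk] le_h.
have recE s x : state_rec Z (fun p : X * Y => p.1)
    (fun p : X * Y * A => F p.1.1 p.1.2 p.2) x s = foldr (F x) (Z x) s.
  by elim: s => //= y s ->.
pose G (p : X * seq Y) := foldr (F p.1) (Z p.1) p.2.
have pG : ptime G.
  apply: (ptime_ext (fun p => recE p.2 p.1)).
  apply: (@ptime_state_rec _ _ _ _ _ _ id (fun n => n.+2 ^ k)) => //.
  - exact: ptime_fst ptime_id.
  - by poly_bounded.
  - by exists k.
  - move=> x s; have -> : foldl (fun x _ => x) x s = x by elim: s.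
    by rewrite esize_pair; lia.
  move=> x s; rewrite recE; apply: leq_trans (le_h _ _) (leq_trans (hk _) _).
  by apply: leq_powS; rewrite esize_pair; lia.
exact: (ptime_comp (ptime_pair ptime_id ptime_l) pG).
Qed.

(** The increase allowed per step does not depend on the accumulator, so the increases add up to a
    polynomial instead of compounding. *)
Lemma ptime_foldr_incr (h : nat -> nat) :
  poly_bounded h ->
  (forall x y a, esize (F x y a) <= esize a + h (esize x + esize y)) ->
  ptime (fun x => foldr (F x) (Z x) (l x)).
Proof.
move=> [k hk] le_h; have [hz [phz mhz le_z]] := ptime_size ptime_Z.
pose pw n := n.+2 ^ k; have ppw : poly_bounded pw by exists k.
apply: (@ptime_foldr (fun n => hz n + n * pw n)); first by poly_bounded.
move=> x s.
have le_s : esize (foldr (F x) (Z x) s) <= hz (esize x) + size s * pw (esize x + esize s).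
  elim: s => [|y s IH] /=; first by have := le_z x; lia.
  have := le_h x y (foldr (F x) (Z x) s); rewrite esize_cons mulSn.
  have := hk (esize x + esize y).
  have := @leq_powS (esize x + esize y) (esize x + (esize y + esize s).+1) k ltac:(lia).
  have : pw (esize x + esize s) <= pw (esize x + (esize y + esize s).+1).
    by apply: leq_powS; lia.
  move/(leq_mul (leqnn (size s))); rewrite -/(pw _) -/(pw _); lia.
have := mhz (esize x) (esize x + esize s) (leq_addr _ _).
have : size s <= esize x + esize s by have := size_leq_esize s; lia.
by move/leq_mul/(_ (leqnn (pw (esize x + esize s)))); lia.
Qed.

End Foldr.

(** * Boolean and list operations *)

Section Booleans.
Context {X Y : encType}.

Lemma ptime_true : ptime (fun _ : X => true).
Proof.
apply: (@ptimeI _ _ _ (fun=> ENode ELeaf ELeaf) (fun=> [::]) (fun=> 3)).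
  by poly_bounded.
by move=> P b _ x env; exists 3 => //;
  apply: (@EvalNode _ _ _ _ Leaf Leaf 1 1); exact: EvalLeaf.
Qed.

Lemma ptime_false : ptime (fun _ : X => false).
Proof. exact: ptime_leaf. Qed.

Lemma ptime_nil : ptime (fun _ : X => [::] : seq Y).
Proof. exact: ptime_leaf. Qed.

Lemma ptime_negb (b : X -> bool) : ptime b -> ptime (fun x => ~~ b x).
Proof. by move=> pb; exact: (ptime_if pb ptime_false ptime_true). Qed.

Lemma ptime_andb (b c : X -> bool) : ptime b -> ptime c -> ptime (fun x => b x && c x).
Proof. by move=> pb pc; exact: (ptime_if pb pc ptime_false). Qed.

Lemma ptime_orb (b c : X -> bool) : ptime b -> ptime c -> ptime (fun x => b x || c x).
Proof. by move=> pb pc; exact: (ptime_if pb ptime_true pc). Qed.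

Lemma ptime_addb (b c : X -> bool) : ptime b -> ptime c -> ptime (fun x => b x (+) c x).
Proof.
move=> pb pc; apply: ptime_ext (ptime_if pb (ptime_negb pc) pc) => x.
by case: (b x).
Qed.

End Booleans.

Lemma ptime_has (X Y : encType) (a : X -> Y -> bool) (l : X -> seq Y) :
  ptime (fun p : X * Y => a p.1 p.2) -> ptime l -> ptime (fun x => has (a x) (l x)).
Proof.
move=> pa pl; apply: (@ptime_ext _ _ (fun x => foldr (fun y b => a x y || b) false (l x))).
  by move=> x; elim: (l x) => //= y s ->.
apply: (@ptime_foldr _ _ _ (fun x y b => a x y || b) (fun=> false) _ _ _ _ (fun=> 3)) => //.
- exact: ptime_false.
- cbv beta; apply: ptime_orb; [exact: ptime_comp (ptime_fst ptime_id) pa |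
    exact: ptime_snd ptime_id].
- by poly_bounded.
by move=> x s; exact: esize_bool.
Qed.

Lemma ptime_map (X Y Z : encType) (f : X -> Y -> Z) (l : X -> seq Y) :
  ptime (fun p : X * Y => f p.1 p.2) -> ptime l ->
  ptime (fun x => [seq f x y | y <- l x]).
Proof.
move=> pf pl; have [h [ph mh le_h]] := ptime_size pf.
apply: (@ptime_ext _ _ (fun x => foldr (fun y a => f x y :: a) [::] (l x))).
  by move=> x; elim: (l x) => //= y s ->.
apply: (@ptime_foldr_incr _ _ _ (fun x y a => f x y :: a) (fun=> [::])
  _ _ _ _ (fun n => h (n + 1) + 1)) => //.
- exact: ptime_nil.
- cbv beta; apply: ptime_cons; [exact: ptime_comp (ptime_fst ptime_id) pf |
    exact: ptime_snd ptime_id].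
- by poly_bounded; apply: (poly_bounded_comp ph); poly_bounded.
move=> x y a; have /= := le_h (x, y); rewrite esize_cons esize_pair addn1 => le_f.
by rewrite addn1 addnS ltnS addnC leq_add2l.
Qed.

Lemma ptime_cat (X Y : encType) (l1 l2 : X -> seq Y) :
  ptime l1 -> ptime l2 -> ptime (fun x => l1 x ++ l2 x).
Proof.
move=> p1 p2; apply: (@ptime_ext _ _ (fun x => foldr cons (l2 x) (l1 x))).
  by move=> x; rewrite /cat; elim: (l1 x) => //= y s ->.
apply: (@ptime_foldr_incr _ _ _ (fun=> cons) _ _ _ _ _ (fun n => n + 1)) => //.
- cbv beta; apply: ptime_cons; [exact: ptime_snd (ptime_fst ptime_id) |
    exact: ptime_snd ptime_id].
- by poly_bounded.
by move=> x y a; rewrite esize_cons; lia.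
Qed.

Lemma ptime_rev (X Y : encType) (l : X -> seq Y) : ptime l -> ptime (fun x => rev (l x)).
Proof.
move=> pl; apply: (@ptime_ext _ _ (fun x => foldr (fun y a => a ++ [:: y]) [::] (l x))).
  by move=> x; elim: (l x) => //= y s ->; rewrite rev_cons cats1.
apply: (@ptime_foldr_incr _ _ _ (fun _ y a => a ++ [:: y]) (fun=> [::])
  _ _ _ _ (fun n => n + 1)) => //.
- exact: ptime_nil.
- cbv beta; apply: ptime_cat; first exact: ptime_snd ptime_id.
  by apply: ptime_cons; [exact: ptime_snd (ptime_fst ptime_id) | exact: ptime_nil].
- by poly_bounded.
by move=> x y a; have := esize_cat a [:: y]; rewrite esize_cons esize_nil; lia.
Qed.

(* Dispatching on the shape of the goal avoids higher-order unification up to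
   unfolding, which may diverge here. *)
Ltac ptime_step := cbv beta; try assumption; lazymatch goal with
  | |- ptime (fun x => x) => exact: ptime_id
  | |- ptime fst => exact: (ptime_fst ptime_id)
  | |- ptime snd => exact: (ptime_snd ptime_id)
  | |- ptime (fun x => fst (@?f x)) => apply: (@ptime_fst _ _ _ f)
  | |- ptime (fun x => snd (@?f x)) => apply: (@ptime_snd _ _ _ f)
  | |- ptime (fun x => (@?f x, @?g x)) => apply: (@ptime_pair _ _ _ f g)
  | |- ptime (fun x => true) => exact: ptime_true
  | |- ptime (fun x => false) => exact: ptime_false
  | |- ptime (fun x => [::]) => exact: ptime_nil
  | |- ptime (fun x => @?f x :: @?g x) => apply: (@ptime_cons _ _ f g)
  | |- ptime (fun x => ~~ (@?f x)) => apply: (@ptime_negb _ f)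
  | |- ptime (fun x => @?f x && @?g x) => apply: (@ptime_andb _ f g)
  | |- ptime (fun x => @?f x || @?g x) => apply: (@ptime_orb _ f g)
  | |- ptime (fun x => @?f x (+) @?g x) => apply: (@ptime_addb _ f g)
  | |- ptime (fun x => if _ then _ else _) => apply: ptime_if
  | |- ptime (fun x => has (@?a x) (@?l x)) => apply: (@ptime_has _ _ a l)
  | |- ptime (fun x => map (@?a x) (@?l x)) => apply: (@ptime_map _ _ _ a l)
  | |- ptime (fun x => @?f x ++ @?g x) => apply: (@ptime_cat _ _ f g)
  | |- ptime (fun x => rev (@?f x)) => apply: (@ptime_rev _ _ f)
  | |- ptime (fun x => behead (@?f x)) => apply: (@ptime_behead _ _ f)
  | |- ptime (fun x => head _ (@?f x)) => apply: (@ptime_head _ _ _ f); first by []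
  end.

Notation carry_encType := (prod_encType bool_encType
  (prod_encType (seq_encType bool_encType) (seq_encType bool_encType))).

(** * Comparison, addition and multiplication of binary numbers *)

Section BinaryArithmetic.
Implicit Types (x y : seq bool).

Fixpoint bits_val x := if x is b :: x' then b + (bits_val x').*2 else 0.

(** As this holds for the empty list too, numbers of different lengths can be read in parallel, the
    shorter one being padded with zeros. *)
Lemma bits_val_head x : bits_val x = head false x + (bits_val (behead x)).*2.
Proof. by case: x. Qed.

Lemma bits_val_of_pos p : bits_val (bits_of_pos p) = nat_of_pos p.
Proof. by elim: p => //= p ->; rewrite NatTrec.doubleE. Qed.

(** The carried bit compares the digits read so far; the next digit is more significant and
    overrules it when the two numbers differ there. *)
Definition lt_step (st : bool * (seq bool * seq bool)) :=
  let: (c, (x, y)) := st in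
  (if head false x (+) head false y then head false y else c,
   (behead x, behead y)).

Definition bits_lt x y := (foldl (fun st _ => lt_step st) (false, (x, y)) (x ++ y)).1.

Lemma bits_ltE x y : bits_lt x y = (bits_val x < bits_val y).
Proof.
suff main (l : seq bool) (c : bool) x' y' : maxn (size x') (size y') <= size l ->
    (foldl (fun st _ => lt_step st) (c, (x', y')) l).1
    = (bits_val x' < bits_val y') || (bits_val x' == bits_val y') && c.
  by rewrite /bits_lt main ?andbF ?orbF // size_cat; lia.
elim: l c x' y' => [|b l IH] c {}x {}y /=.
  by rewrite geq_max !leqn0 !size_eq0 => /andP[/eqP-> /eqP->].
move=> le_l; rewrite IH ?size_behead; last lia.
rewrite (bits_val_head x) (bits_val_head y).
move: (bits_val (behead x)) (bits_val (behead y)) => m n.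
by case: (head false x) (head false y) c => [] [] [] /=; lia.
Qed.

Definition bits_eq x y := ~~ bits_lt x y && ~~ bits_lt y x.

Lemma bits_eqE x y : bits_eq x y = (bits_val x == bits_val y).
Proof. by rewrite /bits_eq !bits_ltE -!leqNgt -eqn_leq eq_sym. Qed.

(** The new carry is the majority of the two digits and the old carry. *)
Definition add_step (p : bool * (seq bool * seq bool) * bool) :=
  let: (c, (x, y)) := p.1 in
  (if head false x (+) head false y then c else head false x,
   (behead x, behead y)).

Definition add_digit (p : bool * (seq bool * seq bool) * bool * seq bool) :=
  let: (c, (x, y)) := p.1.1 in (head false x (+) head false y (+) c) :: p.2.

Definition bits_add_rec := state_rec (St := carry_encType)
  (Y := bool_encType) (A := seq_encType bool_encType) (fun st => [:: st.1]) add_step add_digit.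

(* [x ++ y] only serves as a counter that is long enough. *)
Definition bits_add x y := bits_add_rec (false, (x, y)) (x ++ y).

Lemma size_bits_add_rec st l : size (bits_add_rec st l) = (size l).+1.
Proof. by elim: l st => //= b l IH [c [x y]] /=; rewrite IH. Qed.

Lemma bits_addE x y : bits_val (bits_add x y) = bits_val x + bits_val y.
Proof.
suff main (l : seq bool) (c : bool) x' y' : maxn (size x') (size y') <= size l ->
    bits_val (bits_add_rec (c, (x', y')) l) = c + bits_val x' + bits_val y'.
  by rewrite /bits_add main ?add0n // size_cat; lia.
elim: l c x' y' => [|b l IH] c {}x {}y /=.
  by rewrite geq_max !leqn0 !size_eq0 => /andP[/eqP-> /eqP->] /=; case: c.
move=> le_l; rewrite /add_step /= [bits_val _]IH ?size_behead; last lia.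
rewrite (bits_val_head x) (bits_val_head y).
move: (bits_val (behead x)) (bits_val (behead y)) => m n.
by case: (head false x) (head false y) c => [] [] [] /=; lia.
Qed.

Definition bits_mul x y :=
  foldr (fun (b : bool) a => if b then bits_add y (false :: a) else false :: a) [::] x.

Lemma bits_mulE x y : bits_val (bits_mul x y) = bits_val x * bits_val y.
Proof.
elim: x => //= b x IH; case: b; rewrite ?bits_addE /= IH; lia.
Qed.

End BinaryArithmetic.

Section PtimeArithmetic.
Context {X : encType}.
Implicit Types f g : X -> seq bool.

Lemma ptime_bits_lt f g : ptime f -> ptime g -> ptime (fun x => bits_lt (f x) (g x)).
Proof.
move=> pf pg.
have pG : ptime (fun p : bool * (seq bool * seq bool) * seq bool =>
    state_rec (St := carry_encType) (Y := bool_encType) (A := bool_encType)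
      (fun st => st.1) (fun p => lt_step p.1) (fun p => p.2) p.1 p.2).
  apply: (@ptime_state_rec _ _ _ _ _ _ (fun n => n + 3) (fun=> 3)); try by poly_bounded.
  - by repeat ptime_step.
  - apply: (@ptime_ext _ _ (fun p : bool * (seq bool * seq bool) * bool =>
      (if head false p.1.2.1 (+) head false p.1.2.2 then head false p.1.2.2 else p.1.1,
       (behead p.1.2.1, behead p.1.2.2)))); first by case=> [[c [x y]] b].
    by repeat ptime_step.
  - by repeat ptime_step.
  - move=> [c [x y]] l.
    have le_c : esize c <= 3 by exact: esize_bool.
    suff : esize (foldl (fun st _ => lt_step st) (c, (x, y)) l)
         <= esize x + esize y + 5 by rewrite !esize_pair; lia.
    elim: l c x y {le_c} => [|b l IH] c x y /=.
      by have := esize_bool c; rewrite !esize_pair; lia.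
    apply: leq_trans (IH _ _ _) _.
    have le_behead (s : seq bool) : esize (behead s) <= esize s.
      by case: s => //= d s; rewrite esize_cons; lia.
    by have := le_behead x; have := le_behead y; lia.
  - by move=> s l; exact: esize_bool.
have recE st l : state_rec (St := carry_encType) (Y := bool_encType) (A := bool_encType)
    (fun st => st.1) (fun p => lt_step p.1) (fun p => p.2) st l
    = (foldl (fun st _ => lt_step st) st l).1.
  by elim: l st => //= b l IH st; rewrite IH.
have pH : ptime (fun x => ((false, (f x, g x)), f x ++ g x)) by repeat ptime_step.
apply: ptime_ext (ptime_comp pH pG) => x; exact: recE.
Qed.

Lemma ptime_bits_eq f g : ptime f -> ptime g -> ptime (fun x => bits_eq (f x) (g x)).
Proof.
by move=> pf pg; apply: ptime_andb; apply: ptime_negb; exact: ptime_bits_lt.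
Qed.

Lemma ptime_bits_add f g : ptime f -> ptime g -> ptime (fun x => bits_add (f x) (g x)).
Proof.
move=> pf pg.
have pG : ptime (fun p : bool * (seq bool * seq bool) * seq bool => bits_add_rec p.1 p.2).
  apply: (@ptime_state_rec _ _ _ _ _ _ (fun n => n + 3) (fun n => 4 * n + 9)); try by poly_bounded.
  - by repeat ptime_step.
  - apply: (@ptime_ext _ _ (fun p : bool * (seq bool * seq bool) * bool =>
      (if head false p.1.2.1 (+) head false p.1.2.2 then p.1.1 else head false p.1.2.1,
       (behead p.1.2.1, behead p.1.2.2)))); first by case=> [[c [x y]] b].
    by repeat ptime_step.
  - apply: (@ptime_ext _ _ (fun p : bool * (seq bool * seq bool) * bool * seq bool =>
      (head false p.1.1.2.1 (+) head false p.1.1.2.2 (+) p.1.1.1) :: p.2)).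
      by case=> [[[c [x y]] b] s].
    by repeat ptime_step.
  - move=> [c [x y]] l.
    suff : esize (foldl (fun s b => add_step (s, b)) (c, (x, y)) l)
         <= esize x + esize y + 5 by have := esize_bool c; rewrite !esize_pair; lia.
    elim: l c x y => [|b l IH] c x y /=.
      by have := esize_bool c; rewrite !esize_pair; lia.
    apply: leq_trans (IH _ _ _) _.
    have le_behead (s : seq bool) : esize (behead s) <= esize s.
      by case: s => //= d s; rewrite esize_cons; lia.
    by have := le_behead x; have := le_behead y; lia.
  - move=> s l; apply: leq_trans (esize_bits _) _.
    rewrite size_bits_add_rec esize_pair.
    by have := size_leq_esize (l : seq bool); lia.
have pH : ptime (fun x => ((false, (f x, g x)), f x ++ g x)) by repeat ptime_step.
exact: (ptime_comp pH pG).
Qed.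

End PtimeArithmetic.

Lemma ptime_bits_mul (X : encType) (f g : X -> seq bool) :
  ptime f -> ptime g -> ptime (fun x => bits_mul (f x) (g x)).
Proof.
move=> pf pg.
apply: (ptime_comp (f := fun x => (g x, f x)) (g := fun p => bits_mul p.2 p.1)).
  by apply: ptime_pair.
apply: (@ptime_foldr _ _ _ (fun (p : seq bool * seq bool) (b : bool) a =>
  if b then bits_add p.1 (false :: a) else false :: a) (fun=> [::]) (fun p => p.2)
  _ _ _ (fun n => 4 * (n * (n + 2)) + 1)).
- by repeat ptime_step.
- by repeat ptime_step.
- cbv beta; apply: ptime_if; [by repeat ptime_step | apply: ptime_bits_add | ];
  by repeat ptime_step.
- by poly_bounded.
move=> p s; apply: leq_trans (esize_bits _) _.
set y := p.1; set r := foldr _ _ _.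
(* [bits_add] returns one digit more than both lengths together, so each digit of the multiplier
   lengthens the product by at most [size y + 2]. *)
have le_r : size r <= size s * (size y + 2).
  rewrite /r; elim: s {r} => //= b s; set r := foldr _ _ _ => le_r.
  by case: b; rewrite /bits_add ?size_bits_add_rec ?size_cat /= mulSn; lia.
rewrite addn1 ltnS leq_mul2l /=; apply: leq_trans le_r _.
apply: leq_mul; first by have := size_leq_esize s; lia.
by have := size_leq_esize y; have : esize p = (esize y + esize p.2).+1 by []; lia.
Qed.

(** * Mixing two arborescences *)

Section Walks.
Variable D : digraph.
Implicit Types (T : {set arcs D}) (x y r v : vertices D) (s : seq (arcs D)).

Lemma diwalk_cat x s1 s2 y :
  diwalk x (s1 ++ s2) y =
  diwalk x s1 (last x (map (@target D) s1)) &&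
  diwalk (last x (map (@target D) s1)) s2 y.
Proof. by elim: s1 x => [|a s1 IH] x /=; rewrite ?eqxx ?IH ?andbA. Qed.

Lemma diwalk_rcons x s a y :
  diwalk x (rcons s a) y = diwalk x s (source a) && (target a == y).
Proof. by elim: s x => [|b s IH] x /=; rewrite ?IH ?andbA ?(eq_sym x). Qed.

(** If the path already visited the target of [a], its part from there on, closed by [a], would be a
    cycle. *)
Lemma dipath_rcons T r s a :
  (forall x p, ~~ dicycle T x p) -> a \in T -> dipath T r s (source a) ->
  dipath T r (rcons s a) (target a).
Proof.
move=> acyc aT /and3P[sT walk_s uniq_s].
rewrite /dipath all_rcons aT sT diwalk_rcons walk_s eqxx map_rcons.
rewrite -rcons_cons rcons_uniq uniq_s !andbT /=.
apply/negP => cyc.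
have [s1 [s2 [def_s def_a]]] : exists s1 s2,
    s = s1 ++ s2 /\ last r (map (@target D) s1) = target a.
  move: cyc; rewrite in_cons => /orP[/eqP->|/mapP[b b_s ->]].
    by exists [::], s.
  have [s1 s2] := splitPr b_s; exists (rcons s1 b), s2.
  by rewrite cat_rcons map_rcons last_rcons.
have /negP[] := acyc (target a) (rcons s2 a).
move: sT walk_s uniq_s; rewrite def_s all_cat diwalk_cat def_a map_cat.
move=> /andP[_ s2T] /andP[_ walk_s2]; rewrite -cat_cons cat_uniq.
case/and3P=> _ disj uniq_s2; rewrite /dicycle all_rcons aT s2T diwalk_rcons.
rewrite walk_s2 eqxx map_rcons rcons_uniq uniq_s2 -size_eq0 size_rcons /= andbT.
by apply: contra disj => a_s2; apply/hasP; exists (target a) => //=;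
  rewrite -def_a mem_last.
Qed.

End Walks.

(** * Time-respecting arborescences as ranked arc sets *)

Section Ranked.
Variables (D : digraph) (R : realDomainType) (lambda : arcs D -> R) (r : vertices D).
Implicit Types (T : {set arcs D}) (x y v : vertices D) (s : seq (arcs D)).
Hypothesis lambda_ge0 : forall a, (0 <= lambda a)%R.

(** A local certificate for a time-respecting arborescence: all conditions concern single arcs,
    single vertices or two arcs, and the rank [d] excludes cycles. *)
Record ranked T (d : vertices D -> nat) : Prop := Ranked {
  ranked_inj : {in T &, injective (@target D)};
  ranked_ex : forall v, v != r -> exists2 a, a \in T & target a = v;
  ranked_root : forall a, a \in T -> target a != r;
  ranked_lt : forall a, a \in T -> d (source a) < d (target a);
  ranked_mono : forall a b, a \in T -> b \in T -> target a = source b ->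
    (lambda a <= lambda b)%R
}.

(** The rank is the length of the unique path from [r]; the arcs of that path are distinct, whence
    the bound. *)
Lemma tr_arborescence_ranked T : is_tr_arborescence lambda r T ->
  exists2 d, ranked T d & forall v, d v <= #|arcs D|.
Proof.
move=> [[acyc uniq_path] tr].
have ex_path v : exists s, dipath T r s v by have [s []] := uniq_path v; exists s.
pose p v := xchoose (ex_path v).
have pP v : dipath T r (p v) v := xchooseP (ex_path v).
have pU s v : dipath T r s v -> s = p v.
  by have [s0 [_ s0U]] := uniq_path v => /s0U <-; exact: s0U.
have p_arc a : a \in T -> p (target a) = rcons (p (source a)) a.
  by move=> aT; apply/esym/pU/dipath_rcons.
have p_root : p r = [::] by apply/esym/pU; rewrite /dipath /= eqxx.
exists (fun v => size (p v)); first split.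
- by move=> a b aT bT eq_ab; have := p_arc a aT; rewrite eq_ab p_arc // => /rcons_inj[].
- move=> v v_r; have /and3P[] := pP v.
  case/lastP: (p v) => [|s a]; first by rewrite /= eq_sym (negPf v_r).
  by rewrite all_rcons diwalk_rcons => /andP[aT _] /andP[_ /eqP def_v] _; exists a.
- move=> a aT; apply/eqP => a_r; have := p_arc a aT.
  by rewrite a_r p_root => /(congr1 size); rewrite size_rcons.
- by move=> a aT; rewrite p_arc // size_rcons.
- move=> a b aT bT def_b.
  have lt_a : size (p (source a)) < size (p (target a)) by rewrite p_arc // size_rcons.
  have lt_b : size (p (source b)) < size (p (target b)) by rewrite p_arc // size_rcons.
  (* Ranks increase along the two arcs, so their three ends are distinct and they form a path. *)
  have := tr (source a) [:: a; b] (target b); rewrite /time_respecting_path /= andbT.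
  apply; rewrite /dipath /= aT bT !eqxx def_b eqxx !inE /=.
  rewrite -def_b in lt_b *; apply/and3P; split=> //.
    rewrite negb_or; apply/andP; split; apply: contraTneq (lt_a) => ->; rewrite -leqNgt //.
    exact: ltnW.
  by apply: contraTneq (lt_b) => ->; rewrite -leqNgt.
move=> v; have /and3P[_ _ /= /andP[_ /map_uniq/card_uniqP <-]] := pP v.
exact: max_card.
Qed.

Lemma ranked_walk T d x s y : ranked T d -> all (fun a => a \in T) s -> diwalk x s y ->
  path (fun u v => d u < d v) x (map (@target D) s).
Proof.
move=> rk; elim: s x => //= a s IH x /andP[aT sT] /andP[/eqP <- walk_s].
by rewrite (ranked_lt rk aT) IH.
Qed.

(** Ranks increase along walks, so no vertex repeats. A path from [r] exists by induction on the
    rank, and is unique because tracing it backwards leaves no choice of arc. *)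
Lemma ranked_tr_arborescence T d : ranked T d -> is_tr_arborescence lambda r T.
Proof.
move=> rk; have tr_d : transitive (fun u v => d u < d v).
  by move=> v u w; apply: ltn_trans.
have walk_uniq x s y : all (fun a => a \in T) s -> diwalk x s y -> uniq (x :: map (@target D) s).
  move=> sT /(ranked_walk rk sT) /=; apply: (@sorted_uniq _ _ tr_d _ (x :: _)) => v.
  exact: ltnn.
split; first split.
- move=> x s; apply/negP => /and4P[s0 sT walk_s _].
  have := walk_uniq _ _ _ sT walk_s.
  case/lastP: s s0 sT walk_s => // s a _ _; rewrite diwalk_rcons => /andP[_ /eqP <-].
  by rewrite map_rcons /= mem_rcons inE eqxx.
- move=> x; have [s path_s] : exists s, dipath T r s x.
    have [n] := ubnP (d x); elim: n x => // n IH x lt_x.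
    have [->|/(ranked_ex rk)[a aT def_x]] := eqVneq x r.
      by exists [::]; rewrite /dipath /= eqxx.
    have [|s /and3P[sT walk_s _]] := IH (source a).
      by apply: leq_trans (ranked_lt rk aT) _; rewrite def_x -ltnS.
    have sT' : all (fun a => a \in T) (rcons s a) by rewrite all_rcons; apply/andP.
    have walk_s' : diwalk r (rcons s a) x by rewrite diwalk_rcons walk_s def_x /=.
    by exists (rcons s a); apply/and3P; split; rewrite ?(walk_uniq _ _ _ sT' walk_s').
  exists s; split=> // s' path_s'.
  elim/last_ind: s s' x path_s path_s' => [|s a IH] s' x.
    move=> /and3P[_ /= /eqP <- _] /and3P[]; case/lastP: s' => // s b.
    rewrite all_rcons diwalk_rcons => /andP[bT _] /andP[_ b_r].
    by rewrite (negPf (ranked_root rk bT)) in b_r.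
  move=> /and3P[]; rewrite all_rcons diwalk_rcons => /andP[aT sT] /andP[walk_s /eqP def_x] _.
  move=> /and3P[]; case/lastP: s' => [_ /= r_x|s' b].
    by move: (ranked_root rk aT); rewrite def_x eq_sym r_x.
  rewrite all_rcons diwalk_rcons => /andP[bT sT'] /andP[walk_s' /eqP def_x'] _.
  have def_b : b = a by apply: (ranked_inj rk) => //; rewrite def_x.
  rewrite def_b (IH s' (source a)) //; last rewrite -def_b.
    by rewrite /dipath sT walk_s (walk_uniq _ _ _ sT walk_s).
  by rewrite /dipath sT' walk_s' (walk_uniq _ _ _ sT' walk_s').
move=> x s y /and3P[sT walk_s _]; rewrite /time_respecting_path.
elim: s x sT walk_s => //= a [|b s] IH x //= /andP[aT sT] /andP[_ walk_s].
have /= -> := IH _ sT walk_s; rewrite andbT; case/andP: walk_s => /eqP def_b _.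
by case/andP: sT => bT _; exact: (ranked_mono rk).
Qed.

(* The label of the arc entering [v], and 0 when there is none, as at the root;
   labels being nonnegative, [label T] then increases along the arcs of a
   time-respecting arborescence. *)
Definition label T v : R :=
  if [pick a in T | target a == v] is Some a then lambda a else 0%R.

Lemma label_target T d a : ranked T d -> a \in T -> label T (target a) = lambda a.
Proof.
move=> rk aT; rewrite /label; case: pickP => [b /andP[bT /eqP]|/(_ a)].
  by move/(ranked_inj rk bT aT) ->.
by rewrite aT eqxx.
Qed.

Lemma label_root T d : ranked T d -> label T r = 0%R.
Proof.
move=> rk; rewrite /label; case: pickP => // a /andP[aT].
by rewrite (negPf (ranked_root rk aT)).
Qed.

Lemma label_source T d a : ranked T d -> a \in T -> (label T (source a) <= lambda a)%R.
Proof.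
move=> rk aT; have [->|/(ranked_ex rk)[b bT def_a]] := eqVneq (source a) r.
  by rewrite (label_root rk).
by rewrite -def_a (label_target rk bT) (ranked_mono rk).
Qed.

(** All intermediate sets of both phases have this form. *)
Definition mix T1 T2 (X : {set vertices D}) : {set arcs D} :=
  [set a | a \in if target a \in X then T2 else T1].

Section Mix.
Variables (T1 T2 : {set arcs D}) (d1 d2 : vertices D -> nat).
Hypotheses (rk1 : ranked T1 d1) (rk2 : ranked T2 d2).

(* An arc of [mix T1 T2 X] increases, lexicographically, the label of the
   entering arc, then membership in [X], then the rank in [T1] or [T2]. *)
Lemma mix_tr_arborescence (X : {set vertices D}) :
  (forall v, d1 v <= #|arcs D|) ->
  (forall a, a \in T2 -> target a \in X -> source a \notin X ->
     (label T1 (source a) <= label T2 (source a))%R) ->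
  (forall a, a \in T1 -> target a \notin X -> source a \in X ->
     (label T2 (source a) < label T1 (source a))%R) ->
  is_tr_arborescence lambda r (mix T1 T2 X).
Proof.
move=> d1_le enterX leaveX.
pose cur v := if v \in X then label T2 v else label T1 v.
(* The offset exceeds every [d1], so membership in [X] counts before the ranks. *)
pose m v := if v \in X then #|arcs D|.+1 + d2 v else d1 v.
pose lt u v := (cur u < cur v)%R || (cur u == cur v) && (m u < m v).
have lt_arc a : a \in mix T1 T2 X ->
    (cur (source a) <= lambda a)%R /\ cur (target a) = lambda a /\
    ((cur (source a) < lambda a)%R || (m (source a) < m (target a))).
  rewrite inE /cur /m; case: ifP => tX aT.
    rewrite (label_target rk2 aT); have le2 := label_source rk2 aT.
    case: ifP => [sX | /negbT sX]; first by rewrite ltn_add2l (ranked_lt rk2 aT) orbT.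
    rewrite addSn ltnS (leq_trans (d1_le _)) ?leq_addr // orbT.
    by split=> //; apply: le_trans le2; apply: enterX; rewrite ?tX.
  rewrite (label_target rk1 aT); have le1 := label_source rk1 aT.
  case: ifP => [sX | sX]; last by rewrite (ranked_lt rk1 aT) orbT.
  (* An arc leaving [X] cannot increase [m], but strictly increases the label. *)
  have lt1 : (label T2 (source a) < lambda a)%R.
    by apply: lt_le_trans le1; apply: leaveX => //; rewrite tX.
  by rewrite ltW lt1.
have lt_is_trans : transitive lt.
  move=> v u w /orP[lt_uv|/andP[/eqP eq_uv lt_uv]] /orP[lt_vw|/andP[/eqP eq_vw lt_vw]].
  - by rewrite /lt (lt_trans lt_uv).
  - by rewrite /lt -eq_vw lt_uv.
  - by rewrite /lt eq_uv lt_vw.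
  - by rewrite /lt eq_uv eq_vw eqxx (ltn_trans lt_uv) ?orbT.
(* Labels are not natural numbers; counting the vertices below [v] turns the lexicographic order
   into a rank. *)
apply: (@ranked_tr_arborescence _ (fun v => #|[set u | lt u v]|)); split.
- move=> a b; rewrite !inE => aT bT eq_ab; move: aT bT; rewrite eq_ab.
  by case: ifP => _ aT bT; [apply: (ranked_inj rk2) | apply: (ranked_inj rk1)].
- move=> v v_r; have [vX|vX] := boolP (v \in X).
    by have [a aT def_v] := ranked_ex rk2 v_r; exists a; rewrite // inE def_v vX.
  have [a aT def_v] := ranked_ex rk1 v_r; exists a; rewrite // inE def_v.
  by rewrite (negPf vX).
- move=> a; rewrite inE; case: ifP => _ aT; [exact: (ranked_root rk2) | exact: (ranked_root rk1)].
- move=> a /lt_arc[le_a [cur_a lt_a]]; apply: proper_card; apply/properP.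
  have lt_st : lt (source a) (target a).
    rewrite /lt cur_a; case/orP: lt_a => [->//|->]; rewrite andbT.
    by rewrite orbC -le_eqVlt.
  split.
    by apply/subsetP => u; rewrite !inE => lt_u; exact: lt_is_trans lt_st.
  by exists (source a); rewrite inE // /lt ltxx ltnn andbF.
- by move=> a b /lt_arc[_ [<- _]] /lt_arc[le_b _] eq_ab; rewrite eq_ab.
Qed.

End Mix.

End Ranked.

(** * The two phases *)

Section Algorithm.
Variables (A V : Type) (eqv : V -> V -> bool) (src tgt : A -> V) (arcs : seq A).

Definition vmem v (L : seq V) := has (eqv v) L.

(** One pass over the arcs; a newly reached vertex goes to the front, hence before its parent. *)
Definition visit (inT : A -> bool) (L0 : seq V) :=
  foldr (fun a L => if inT a && vmem (src a) L && ~~ vmem (tgt a) L then tgt a :: L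
                    else L) L0 arcs.

(* The vertices in an order in which a vertex precedes its parent in [T]; every
   round of [visit] reaches at least one more level of [T]. *)
Definition leaves_to_root inT r := foldr (fun _ L => visit inT L) [:: r] arcs.

Definition improves (inS inG : A -> bool) (cmp : A -> A -> bool) v :=
  has (fun a => inG a && ~~ inS a && eqv (tgt a) v &&
    has (fun b => inS b && eqv (tgt b) v && cmp a b) arcs) arcs.

End Algorithm.

(** * Invariance of the algorithm under a change of representation *)

Section Transfer.
Variables (A V A' V' : Type) (eqv : V -> V -> bool) (eqv' : V' -> V' -> bool).
Variables (src tgt : A -> V) (src' tgt' : A' -> V') (f : A -> A') (g : V -> V').
Hypothesis eqv_g : forall u v, eqv' (g u) (g v) = eqv u v.
Hypothesis src_f : forall a, src' (f a) = g (src a).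
Hypothesis tgt_f : forall a, tgt' (f a) = g (tgt a).
Variable arcs : seq A.

Lemma vmem_map v L : vmem eqv' (g v) (map g L) = vmem eqv v L.
Proof. by rewrite /vmem has_map; apply: eq_has => u /=; rewrite eqv_g. Qed.

Lemma leaves_to_root_map inT inT' r : (forall a, inT' (f a) = inT a) ->
  leaves_to_root eqv' src' tgt' (map f arcs) inT' (g r)
  = map g (leaves_to_root eqv src tgt arcs inT r).
Proof.
move=> inT_f; rewrite /leaves_to_root foldr_map.
have visit_map L : visit eqv' src' tgt' (map f arcs) inT' (map g L)
    = map g (visit eqv src tgt arcs inT L).
  rewrite /visit foldr_map; elim: (arcs) => //= a s ->.
  by rewrite inT_f src_f tgt_f !vmem_map; case: ifP.
(* The induction is on the arcs that count the rounds; those scanned by [visit] stay fixed. *)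
by elim: {2 4}arcs => //= _ s ->.
Qed.

Lemma improves_map inS inG cmp inS' inG' cmp' v :
  (forall a, inS' (f a) = inS a) -> (forall a, inG' (f a) = inG a) ->
  (forall a b, cmp' (f a) (f b) = cmp a b) ->
  improves eqv' tgt' (map f arcs) inS' inG' cmp' (g v)
  = improves eqv tgt arcs inS inG cmp v.
Proof.
move=> inS_f inG_f cmp_f; rewrite /improves has_map; apply: eq_has => a /=.
rewrite inS_f inG_f tgt_f eqv_g has_map; congr (_ && _); apply: eq_has => b /=.
by rewrite inS_f tgt_f eqv_g cmp_f.
Qed.

End Transfer.

(** * The algorithm on digraphs *)

Section GraphAlgorithm.
Variable D : digraph.
Implicit Types (T S G : {set arcs D}) (u v r : vertices D).

Definition graph_order T r : seq (vertices D) :=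
  leaves_to_root eq_op (@source D) (@target D) (enum (arcs D)) (fun a => a \in T) r.

Definition graph_improves S G cmp : pred (vertices D) :=
  improves eq_op (@target D) (enum (arcs D)) (fun a => a \in S) (fun a => a \in G) cmp.

Definition redirect G v S := [set a | a \in if target a == v then G else S].

(** Vertices are treated from the end of [L], and the newest set is put in front. The list is never
    empty, so the default [set0] is never taken. *)
Definition exchanges S G (c : pred (vertices D)) (L : seq (vertices D)) :=
  foldr (fun v Ts => if c v then redirect G v (head set0 Ts) :: Ts else Ts) [:: S] L.

Lemma vmemE v L : vmem eq_op v L = (v \in L).
Proof. by elim: L => //= u L ->; rewrite in_cons. Qed.

Lemma graph_improvesP S G (cmp : rel (arcs D)) v :
  reflect (exists a b, [/\ a \in G, a \notin S, b \in S, target a = v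
                         & target b = v /\ cmp a b])
          (graph_improves S G cmp v).
Proof.
apply: (iffP hasP) => [[a _ /andP[/andP[/andP[aG aS] /eqP ta]]]|].
  by case/hasP=> b _ /andP[/andP[bS /eqP tb] ab]; exists a, b.
move=> [a [b [aG aS bS ta [tb ab]]]]; exists a; rewrite ?mem_enum //.
rewrite aG (negPf aS) ta eqxx; apply/hasP; exists b.
  by rewrite mem_enum.
by rewrite bS tb eqxx.
Qed.

Lemma exchangeC S T : exchange S T = exchange T S.
Proof. exact: andbC. Qed.

Section Order.
Variables (T : {set arcs D}) (r : vertices D).

Fixpoint parents_later (L : seq (vertices D)) :=
  if L is v :: L' then
    ((v == r) || [exists a in T, (target a == v) && (source a \in L')])
    && parents_later L'
  else true.

Lemma parents_later_catr L1 L2 : parents_later (L1 ++ L2) -> parents_later L2.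
Proof. by elim: L1 => //= v L1 IH /andP[_ /IH]. Qed.

Let visit_T := visit eq_op (@source D) (@target D) (enum (arcs D)) (fun a => a \in T).

Lemma visit_sub L v : v \in L -> v \in visit_T L.
Proof.
rewrite /visit_T /visit => vL; elim: (enum _) => //= a s IH.
by case: ifP => // _; rewrite in_cons IH orbT.
Qed.

Lemma visit_target L a : a \in T -> source a \in L -> target a \in visit_T L.
Proof.
rewrite /visit_T /visit => aT aL; have : a \in enum (arcs D) by rewrite mem_enum.
elim: (enum _) => //= b s IH; rewrite in_cons => /orP[/eqP <-|/IH IHa]; last first.
  by case: ifP => // _; rewrite in_cons IHa orbT.
rewrite !vmemE aT /=.
set L' := foldr _ _ s; have -> /= : source a \in L'.
  by rewrite /L'; elim: (s) => //= c s' IHs; case: ifP; rewrite // in_cons IHs orbT.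
by case: ifP => [_|/negbFE //]; rewrite mem_head.
Qed.

Lemma visit_order L : parents_later L -> uniq L ->
  parents_later (visit_T L) && uniq (visit_T L).
Proof.
rewrite /visit_T /visit => pL uL; elim: (enum _) => [|a s IH] /=; first by rewrite pL.
set L' := foldr _ _ s in IH *; case: ifP => // /andP[/andP[aT sL]].
move: sL; rewrite !vmemE => sL tL; case/andP: IH => pL' uL'.
rewrite /= pL' uL' tL !andbT; apply/orP; right; apply/existsP; exists a.
by rewrite eqxx sL; apply/andP.
Qed.

Lemma graph_orderP : parents_later (graph_order T r) && uniq (graph_order T r).
Proof.
rewrite /graph_order /leaves_to_root; elim: {2 4}(enum _) => [|a s /andP[pL uL]] /=.
  by rewrite eqxx.
exact: visit_order.
Qed.

End Order.

(** After [k] rounds all vertices of rank at most [k] are listed, and the number of rounds is the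
    number of arcs. *)
Lemma mem_graph_order (R : realDomainType) (lambda : arcs D -> R) T r d v :
  ranked lambda r T d -> d v <= #|arcs D| -> v \in graph_order T r.
Proof.
move=> rk; rewrite /graph_order /leaves_to_root cardE.
set F := (F in foldr F); elim: (enum _) v => [|b s IH] v le_v; have [->|v_r] := eqVneq v r.
- by rewrite mem_head.
- have [a /(ranked_lt rk) lt_a def_v] := ranked_ex rk v_r.
  by move: le_v; rewrite leqn0 -def_v => /eqP dv; rewrite dv in lt_a.
- by apply: visit_sub; elim: (s) => [|? ? ?]; [exact: mem_head | exact: visit_sub].
have [a aT def_v] := ranked_ex rk v_r; rewrite -def_v; apply: visit_target => //.
apply: IH; have := ranked_lt rk aT; rewrite def_v; move: le_v; rewrite /=; lia.
Qed.

(** The vertices treated at any moment form a tail of the order. Its closure under parents controls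
    the arcs that cross the border of [X] in [mix_tr_arborescence]. *)
Lemma parents_later_closed (R : realDomainType) (lambda : arcs D -> R) T r d L a :
  ranked lambda r T d -> parents_later T r L -> a \in T ->
  target a \in L -> source a \in L.
Proof.
move=> rk + aT; elim: L => //= v L IH /andP[/orP pv pL].
rewrite !in_cons => /orP[/eqP def_v|/(IH pL) ->]; last by rewrite orbT.
case: pv => [/eqP v_r|/existsP[b /andP[bT /andP[/eqP tb sb]]]].
  by case/eqP: (ranked_root rk aT); rewrite def_v.
have -> : a = b by apply: (ranked_inj rk); rewrite // tb.
by rewrite sb orbT.
Qed.

(** * Sequences of exchanges at successive vertices *)

Section Exchanges.
Variables (S G : {set arcs D}) (c : pred (vertices D)).
Hypothesis S_inj : {in S &, injective (@target D)}.
Hypothesis G_inj : {in G &, injective (@target D)}.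
Hypothesis improvable : forall v, c v -> exists a b,
  [/\ a \in G, a \notin S, b \in S, target a = v & target b = v].

Lemma head_exchanges L :
  head set0 (exchanges S G c L) = mix S G [set v in L | c v].
Proof.
elim: L => [|v L IH] /=; first by apply/setP => a; rewrite !inE.
case: ifP => cv /=; rewrite IH; apply/setP => a; rewrite !inE.
  by have [->|_] := eqVneq (target a) v; rewrite ?cv ?inE.
by have [->|_] := eqVneq (target a) v; rewrite ?cv ?andbF.
Qed.

Lemma mem_exchanges L T : T \in exchanges S G c L ->
  exists L1 L2, L = L1 ++ L2 /\ T = mix S G [set v in L2 | c v].
Proof.
have head_case L' : T = head set0 (exchanges S G c L') ->
    exists L1 L2, L' = L1 ++ L2 /\ T = mix S G [set v in L2 | c v].
  by rewrite head_exchanges => ->; exists [::], L'.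
elim: L => [|v L IH]; first by rewrite inE => /eqP/(head_case [::]).
have [tT /= | ] := eqVneq T (head set0 (exchanges S G c (v :: L))).
  by move=> _; exact: head_case.
have sub : T \in exchanges S G c L -> exists L1 L2, v :: L = L1 ++ L2 /\
    T = mix S G [set v in L2 | c v].
  by case/IH => L1 [L2 [-> ->]]; exists (v :: L1), L2.
move=> /=; case: ifP => // _ /=; rewrite in_cons => /negPf -> /=; exact: sub.
Qed.

Lemma last_exchanges L T : last T (exchanges S G c L) = S.
Proof. by elim: L T => //= v L IH T; case: ifP => _ /=; rewrite IH. Qed.

Lemma size_exchanges L : size (exchanges S G c L) = (count c L).+1.
Proof. by elim: L => //= v L IH; case: ifP => _ /=; rewrite ?IH. Qed.

Lemma sorted_exchanges L : uniq L -> sorted (@exchange D) (exchanges S G c L).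
Proof.
elim: L => //= v L IH /andP[vL /IH {}IH]; case: ifP => // cv /=.
have := head_exchanges L; move: IH; case: (exchanges S G c L) => //= T Ts -> ->.
rewrite andbT; have [a [b [aG aS bS ta tb]]] := improvable cv.
(* As [v] has not been treated before, it is still entered by its arc [b] of [S], which [redirect]
   replaces by [a]. *)
have mixv e : target e = v -> (e \in mix S G [set u in L | c u]) = (e \in S).
  by move=> te; rewrite !inE te (negPf vL).
apply/andP; split; apply/eqP.
  rewrite -(cards1 a); congr #|pred_of_set _|; apply/setP => e; rewrite in_setD in_set1.
  rewrite [e \in redirect _ _ _]inE; have [te|te] := eqVneq (target e) v.
    rewrite mixv //; apply/andP/eqP => [[_ eG]|->//].
    by apply: G_inj; rewrite // te.
  by rewrite andNb; apply/esym/eqP => ea; rewrite ea ta eqxx in te.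
rewrite -(cards1 b); congr #|pred_of_set _|; apply/setP => e; rewrite in_setD in_set1.
rewrite [e \in redirect _ _ _]inE; have [te|te] := eqVneq (target e) v.
  rewrite mixv //; apply/andP/eqP => [[_ eS]|->]; first by apply: S_inj; rewrite // te.
  split=> //; apply: contra aS => bG.
  by have -> : a = b by apply: G_inj; rewrite // ta.
by rewrite andNb; apply/esym/eqP => eb; rewrite eb tb eqxx in te.
Qed.

End Exchanges.

End GraphAlgorithm.

(** * Correctness and length of the two phases *)

Section Reconfiguration.
Variables (D : digraph) (R : realDomainType) (lambda : arcs D -> R) (r : vertices D).
Variables T1 T2 : {set arcs D}.

Let decreases a b := (lambda a < lambda b)%R.
(** Equal labels lead to an exchange in this phase only. In negated form, both phases use the same
    strict comparison. *)
Let not_increases a b := ~~ (lambda b < lambda a)%R.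

Definition first_phase :=
  exchanges T1 T2 (graph_improves T1 T2 decreases) (graph_order T2 r).
Definition second_phase :=
  exchanges T2 T1 (graph_improves T2 T1 not_increases) (graph_order T1 r).
(** Each phase lists its newest set first: the first one is reversed, and [behead] drops the common
    final set of the phases from the second. *)
Definition reconfiguration := rev first_phase ++ behead second_phase.

Hypothesis lambda_ge0 : forall a, (0 <= lambda a)%R.
Variables d1 d2 : vertices D -> nat.
Hypotheses (rk1 : ranked lambda r T1 d1) (rk2 : ranked lambda r T2 d2).
Hypotheses (d1_le : forall v, d1 v <= #|arcs D|) (d2_le : forall v, d2 v <= #|arcs D|).

Let lab1 := label lambda T1.
Let lab2 := label lambda T2.
Let c1 := graph_improves T1 T2 decreases.
Let c2 := graph_improves T2 T1 not_increases.

(** At the root both labels are 0 and no arc enters, so both sides fail; elsewhere each tree has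
    exactly one entering arc, and a strict decrease forces the two to differ. *)
Lemma c1E v : c1 v = (lab2 v < lab1 v)%R.
Proof.
apply/graph_improvesP/idP => [[a [b [aG aS bS ta [tb]]]]|lt21].
  by rewrite /lab1 /lab2 -{1}ta -{1}tb (label_target rk1 bS) (label_target rk2 aG).
have v_r : v != r.
  by apply: contraTneq lt21 => ->; rewrite /lab1 /lab2 (label_root rk1) (label_root rk2) ltxx.
have [b bT1 tb] := ranked_ex rk1 v_r; have [a aT2 ta] := ranked_ex rk2 v_r.
have lt_ab : decreases a b.
  by move: lt21; rewrite /lab1 /lab2 -{1}ta -{1}tb (label_target rk1 bT1) (label_target rk2 aT2).
exists a, b; split=> //; apply: contraTN lt_ab => aT1.
by rewrite (ranked_inj rk1 aT1 bT1) ?ta // /decreases ltxx.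
Qed.

(** The comparison is not strict here, so that the two arcs differ has to be stated separately. *)
Lemma c2P v : reflect ((lab1 v <= lab2 v)%R /\ exists2 a, a \in T1 :\: T2 & target a = v) (c2 v).
Proof.
apply: (iffP (graph_improvesP _ _ _ _)) => [[a [b [aG aS bS ta [tb]]]]|].
  rewrite /not_increases -leNgt => le_ab; split; last by exists a; rewrite // inE aS.
  by rewrite /lab1 /lab2 -{1}ta -{1}tb (label_target rk2 bS) (label_target rk1 aG).
move=> [le12 [a]]; rewrite inE => /andP[aT2 aT1] ta.
have v_r : v != r by rewrite -ta (ranked_root rk1).
have [b bT2 tb] := ranked_ex rk2 v_r; exists a, b; split=> //; split=> //.
move: le12; rewrite /lab1 /lab2 -{1}ta -{1}tb (label_target rk2 bT2) (label_target rk1 aT1).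
by rewrite /not_increases -leNgt.
Qed.

(** A vertex with [lab1 v <= lab2 v] that fails [c2] is entered by the same arc in both trees, so
    counting it as exchanged does not change the set. *)
Lemma mix21 (L : seq (vertices D)) :
  mix T2 T1 [set v in L | c2 v] = mix T1 T2 (~: [set v in L | (lab1 v <= lab2 v)%R]).
Proof.
apply/setP => e; rewrite !inE; set v := target e.
have [vL /=|//] := boolP (v \in L).
case: c2P => [[-> _]//|not_c2]; case: ifP => //= /negbFE le12.
apply/idP/idP => eT; apply/negPn/negP => eT'.
  have v_r : v != r by exact: (ranked_root rk2).
  have [a aT1 ta] := ranked_ex rk1 v_r; case: not_c2; split=> //; exists a => //.
  rewrite inE aT1 andbT; apply: contra eT' => aT2.
  by rewrite (ranked_inj rk2 eT aT2) // ta.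
by case: not_c2; split=> //; exists e; rewrite // inE eT'.
Qed.

Lemma improvable1 v : c1 v -> exists a b,
  [/\ a \in T2, a \notin T1, b \in T1, target a = v & target b = v].
Proof. by case/graph_improvesP=> a [b [? ? ? ? []]]; exists a, b. Qed.

Lemma improvable2 v : c2 v -> exists a b,
  [/\ a \in T1, a \notin T2, b \in T2, target a = v & target b = v].
Proof. by case/graph_improvesP=> a [b [? ? ? ? []]]; exists a, b. Qed.

(** Here [X] is the set of treated vertices with [lab2 v < lab1 v]. If an arc of [T2] enters [X]
    from outside, its source is treated as well, so it fails the strict inequality; an arc leaving
    [X] has its source in [X]. *)
Lemma first_phase_tr T : T \in first_phase -> is_tr_arborescence lambda r T.
Proof.
case/(mem_exchanges (S := T1) (G := T2)) => L1 [L2 [def_L ->]].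
have /andP[pL _] := graph_orderP T2 r.
have pL2 : parents_later T2 r L2 by apply: (@parents_later_catr _ _ _ L1); rewrite -def_L.
apply: (mix_tr_arborescence lambda_ge0 rk1 rk2 d1_le) => a aT.
  rewrite !inE -/c1 => /andP[tL _].
  by rewrite (parents_later_closed rk2 pL2 aT tL) /= c1E -leNgt.
by move=> _; rewrite inE -/c1 c1E => /andP[].
Qed.

(** Now the complement of [X] consists of the treated vertices with [lab1 v <= lab2 v], and closure
    under parents in [T1] is used for the arcs leaving [X]. *)
Lemma second_phase_tr T : T \in second_phase -> is_tr_arborescence lambda r T.
Proof.
case/(mem_exchanges (S := T2) (G := T1)) => L1 [L2 [def_L ->]].
have /andP[pL _] := graph_orderP T1 r.
have pL2 : parents_later T1 r L2 by apply: (@parents_later_catr _ _ _ L1); rewrite -def_L.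
rewrite -/c2 mix21; apply: (mix_tr_arborescence lambda_ge0 rk1 rk2 d1_le) => a aT.
  by rewrite !inE negbK => _ /andP[].
rewrite !inE negbK => /andP[tL _].
by rewrite (parents_later_closed rk1 pL2 aT tL) /= -ltNge.
Qed.

(** In the end all vertices are treated, and both phases use [T2] exactly where
    [lab2 v < lab1 v]. *)
Lemma phases_meet : head set0 first_phase = head set0 second_phase.
Proof.
rewrite /first_phase /second_phase !head_exchanges -/c1 -/c2 mix21.
congr mix; apply/setP => v; rewrite !inE c1E.
by rewrite (mem_graph_order rk2) // (mem_graph_order rk1) // ltNge.
Qed.

(** The vertices exchanged in the two phases are disjoint sets whose union is the set of targets of
    [T1 :\: T2], on which [target] is injective. *)
Lemma count_phases :
  count c1 (graph_order T2 r) + count c2 (graph_order T1 r) = #|T1 :\: T2|.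
Proof.
have countE c T d : ranked lambda r T d -> (forall v, d v <= #|arcs D|) ->
    count c (graph_order T r) = #|[set v | c v]|.
  move=> rk d_le; have /andP[_ uL] := graph_orderP T r.
  have /permP -> : perm_eq (graph_order T r) (enum (vertices D)).
    apply: uniq_perm; rewrite ?enum_uniq // => v.
    by rewrite mem_enum (mem_graph_order rk) // d_le.
  by rewrite cardsE cardE -size_filter [in LHS]enumT [in RHS]/enum_mem; congr size; apply: eq_filter.
rewrite (countE _ _ _ rk2 d2_le) (countE _ _ _ rk1 d1_le) -cardsUI.
have -> : [set v | c1 v] :&: [set v | c2 v] = set0.
  apply/setP => v; rewrite !inE c1E; apply/negP => /andP[lt21 /c2P[]].
  by rewrite leNgt lt21.
rewrite cards0 addn0 -(card_in_imset (f := @target D)); last first.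
  by move=> a b /setDP[aT1 _] /setDP[bT1 _]; exact: (ranked_inj rk1).
congr #|pred_of_set _|; apply/setP => v; rewrite !inE; apply/orP/imsetP.
  case=> [c1v|/c2P[_ [a aT ta]]]; last by exists a.
  have [a [b [aT2 aT1 bT1 ta tb]]] := improvable1 c1v; exists b; rewrite // inE bT1 andbT.
  by apply: contra aT1 => bT2; rewrite (ranked_inj rk2 aT2 bT2) // ta.
move=> [a aT def_v]; have [lt21|le12] := ltP (lab2 v) (lab1 v).
  by left; rewrite c1E.
by right; apply/c2P; split=> //; exists a.
Qed.

Lemma reconfigurationP :
  [/\ reconfiguration_seq T1 T2 reconfiguration,
      forall T, T \in reconfiguration -> is_tr_arborescence lambda r T
    & reconfiguration_length reconfiguration = #|T1 :\: T2|].
Proof.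
have valid T : T \in reconfiguration -> is_tr_arborescence lambda r T.
  rewrite mem_cat mem_rev => /orP[/first_phase_tr//|/mem_behead]; exact: second_phase_tr.
have size1 : size first_phase = (count c1 (graph_order T2 r)).+1 by exact: size_exchanges.
have size2 : size second_phase = (count c2 (graph_order T1 r)).+1 by exact: size_exchanges.
have last1 T : last T first_phase = T1 by exact: last_exchanges.
have last2 T : last T second_phase = T2 by exact: last_exchanges.
have /andP[_ uL1] := graph_orderP T1 r; have /andP[_ uL2] := graph_orderP T2 r.
have sorted1 : sorted (@exchange D) first_phase.
  by apply: sorted_exchanges uL2; [exact: (ranked_inj rk1) | exact: (ranked_inj rk2)
    | exact: improvable1].
have sorted2 : sorted (@exchange D) second_phase.
  by apply: sorted_exchanges uL1; [exact: (ranked_inj rk2) | exact: (ranked_inj rk1)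
    | exact: improvable2].
split=> //; last first.
  rewrite /reconfiguration_length size_cat size_rev size_behead size1 size2.
  by rewrite -count_phases.
split; first by move=> T /valid[]; exists r.
- move: size1 last1; rewrite /reconfiguration; case/lastP: first_phase => // s T _.
  by move/(_ T); rewrite last_rcons rev_rcons => ->.
- move: size1 size2 last2 phases_meet; rewrite /reconfiguration.
  case: first_phase => // T s _; case: second_phase => // T' s' _ /= last2 ->.
  by rewrite last_cat rev_cons last_rcons -(last2 T').
(* Reversal is harmless because [exchange] is symmetric. *)
have rev1 : sorted (@exchange D) (rev first_phase).
  rewrite rev_sorted; move: sorted1; case: first_phase => //= T s.
  by rewrite (@eq_path _ _ (fun x y => exchange y x)) // => S' S''; exact: exchangeC.
move: size1 size2 rev1 sorted2 phases_meet; rewrite /reconfiguration.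
case: first_phase => // T s _; case: second_phase => // T' s' _ + + /= def_T.
rewrite -def_T rev_cons -cats1 -catA.
case: (rev s) => [|T0 s0] //=; rewrite !cat_path /= => /andP[-> /andP[-> _]] ->.
by [].
Qed.

End Reconfiguration.

(** * The algorithm on encoded instances *)

(** Missing bits count as [false], so the length is that of [s] on every input, also on one that
    encodes no instance. *)
Fixpoint pair_bits Y (s : seq Y) (t : seq bool) : seq (Y * bool) :=
  if s is y :: s' then (y, head false t) :: pair_bits s' (behead t) else [::].

Lemma pair_bits_map A Y (f : A -> Y) (p : A -> bool) s :
  pair_bits (map f s) (map p s) = [seq (f a, p a) | a <- s].
Proof. by elim: s => //= a s ->. Qed.

Lemma size_pair_bits Y (s : seq Y) t : size (pair_bits s t) = size s.
Proof. by elim: s t => //= y s IH t; rewrite IH. Qed.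

Lemma esize_pair_bits (Y : encType) (s : seq Y) t : esize (pair_bits s t) <= 6 * esize s.
Proof.
elim: s t => [|y s IH] t //=; rewrite !esize_cons esize_pair.
by have := esize_bool (head false t); have := IH (behead t); lia.
Qed.

(** A recursion on the list [l x] whose state is the rest of the bit vector. *)
Lemma ptime_pair_bits (X Y : encType) (l : X -> seq Y) (t : X -> seq bool) :
  ptime l -> ptime t -> ptime (fun x => pair_bits (l x) (t x)).
Proof.
move=> pl pt.
have recE (s : seq bool) (l' : seq Y) : state_rec (St := seq_encType bool_encType) (Y := Y)
      (A := seq_encType (prod_encType Y bool_encType))
      (fun=> [::]) (fun p => behead p.1)
      (fun p => (p.1.2, head false p.1.1) :: p.2) s l' = pair_bits l' s.
  by elim: l' s => //= y l' IH s; rewrite IH.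
have pG : ptime (fun p : seq bool * seq Y =>
    state_rec (St := seq_encType bool_encType) (Y := Y)
      (A := seq_encType (prod_encType Y bool_encType))
      (fun=> [::]) (fun p => behead p.1)
      (fun p => (p.1.2, head false p.1.1) :: p.2) p.1 p.2).
  apply: (@ptime_state_rec _ _ _ _ _ _ id (fun n => 6 * n)); try by poly_bounded.
  - by repeat ptime_step.
  - by repeat ptime_step.
  - by repeat ptime_step.
  - move=> s l'; rewrite esize_pair.
    suff le_s : esize (foldl (fun s0 (y : Y) => behead (s0, y).1) s l') <= esize s.
      by apply: leq_trans le_s _; rewrite /=; lia.
    elim: l' s => //= y l' IH s; apply: leq_trans (IH _) _.
    by case: s => //= b s; rewrite esize_cons; lia.
  move=> s l'; rewrite recE esize_pair.
  by have := esize_pair_bits l' s; lia.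
have pH : ptime (fun x => (t x, l x)) by repeat ptime_step.
apply: ptime_ext (ptime_comp pH pG) => x; exact: recE.
Qed.

(** * The algorithm on bit strings *)

Section BitAlgorithm.

(* An arc: its source, its target, the numerator and the denominator of its
   label, and its membership in [T1] and in [T2]. *)
Definition item : Type :=
  ((seq bool * (seq bool * (seq bool * seq bool))) * bool * bool)%type.
Implicit Types (it : item) (l : seq item).

Definition item_src it := it.1.1.1.
Definition item_tgt it := it.1.1.2.1.
Definition item_lt it it' :=
  bits_lt (bits_mul it.1.1.2.2.1 it'.1.1.2.2.2) (bits_mul it'.1.1.2.2.1 it.1.1.2.2.2).
Definition in_fst it := it.1.2.
Definition in_snd it := it.2.

Definition bits_redirect l (inG : item -> bool) v (cur : seq bool) :=
  [seq if bits_eq (item_tgt p.1) v then inG p.1 else p.2 | p <- pair_bits l cur].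

Definition bits_exchanges l (inG : item -> bool) (c : seq bool -> bool) L cur :=
  foldr (fun v Ts => if c v then bits_redirect l inG v (head [::] Ts) :: Ts else Ts)
    [:: cur] L.

Definition bits_phase l (inS inG : item -> bool) cmp r cur :=
  bits_exchanges l inG (improves bits_eq item_tgt l inS inG cmp)
    (leaves_to_root bits_eq item_src item_tgt l inG r) cur.

(** The components of [x] follow [enc_instance]: vertices, arcs, root, [T1] and [T2]. *)
Definition bits_reconfiguration
    (x : seq (seq bool) * (seq (seq bool * (seq bool * (seq bool * seq bool))) *
         (seq bool * (seq bool * seq bool)))) :=
  rev (bits_phase (pair_bits (pair_bits x.2.1 x.2.2.2.1) x.2.2.2.2)
         in_fst in_snd item_lt x.2.2.1 x.2.2.2.1) ++
  behead (bits_phase (pair_bits (pair_bits x.2.1 x.2.2.2.1) x.2.2.2.2)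
         in_snd in_fst (fun a b => ~~ item_lt b a) x.2.2.1 x.2.2.2.2).

End BitAlgorithm.

Notation item_encType := (prod_encType (prod_encType (prod_encType (seq_encType bool_encType)
  (prod_encType (seq_encType bool_encType) (prod_encType (seq_encType bool_encType)
  (seq_encType bool_encType)))) bool_encType) bool_encType).

Ltac ptime_auto := repeat first [ptime_step | lazymatch goal with
  | |- ptime (fun x => bits_eq (@?f x) (@?g x)) => apply: (@ptime_bits_eq _ f g)
  | |- ptime (fun x => bits_lt (@?f x) (@?g x)) => apply: (@ptime_bits_lt _ f g)
  | |- ptime (fun x => bits_mul (@?f x) (@?g x)) => apply: (@ptime_bits_mul _ f g)
  | |- ptime (fun x => pair_bits (@?f x) (@?g x)) => apply: (@ptime_pair_bits _ _ f g)
  end | match goal with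
  | H : ptime ?g |- ptime (fun x => ?g (@?f x)) =>
      apply: (@ptime_comp _ _ _ f g); last exact: H
  | H : ptime (fun p => ?g p.1 p.2) |- ptime (fun x => ?g (@?f1 x) (@?f2 x)) =>
      refine (ptime_comp (f := fun x => (f1 x, f2 x)) _ H)
  end].

Lemma ptime_item_src : ptime (X := item_encType) item_src.
Proof. by rewrite /item_src; ptime_auto. Qed.

Lemma ptime_item_tgt : ptime (X := item_encType) item_tgt.
Proof. by rewrite /item_tgt; ptime_auto. Qed.

Lemma ptime_item_lt : ptime (X := prod_encType item_encType item_encType)
  (fun p => item_lt p.1 p.2).
Proof. by rewrite /item_lt; ptime_auto. Qed.

Lemma esize_item_tgt (it : item_encType) : esize (item_tgt it) <= esize it.
Proof. by case: it => [[[s [t [n d]]] b] b']; rewrite !esize_pair /item_tgt /=; lia. Qed.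

(** * Running time of a phase *)

Section PtimePhase.
Variables (inS inG : item_encType -> bool) (cmp : item_encType -> item_encType -> bool).
Hypotheses (ptime_inS : ptime inS) (ptime_inG : ptime inG).
Hypothesis ptime_cmp : ptime (fun p => cmp p.1 p.2).

Lemma ptime_visit : ptime (fun p : seq item_encType * seq (seq bool) =>
  visit bits_eq item_src item_tgt p.1 inG p.2).
Proof.
have p1 := ptime_item_src; have p2 := ptime_item_tgt.
apply: (@ptime_foldr_incr _ _ _ (fun (_ : seq item_encType * seq (seq bool)) (a : item_encType) L =>
  if inG a && vmem bits_eq (item_src a) L && ~~ vmem bits_eq (item_tgt a) L
  then item_tgt a :: L else L) (fun p => p.2) (fun p => p.1) _ _ _ (fun n => n + 1)).
- by ptime_auto.
- by ptime_auto.
- by rewrite /vmem; ptime_auto.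
- by poly_bounded.
move=> p a L; case: ifP => _; last by lia.
by rewrite esize_cons; have := esize_item_tgt a; lia.
Qed.

(** The bound is additive, so iterating [visit] once per arc keeps the list polynomially small. *)
Lemma esize_visit (l : seq item_encType) (L : seq (seq bool)) :
  esize (visit bits_eq item_src item_tgt l inG L) <= esize L + esize l.
Proof.
rewrite /visit; elim: l => [|a l IH] /=; first by lia.
rewrite [esize (a :: l)]esize_cons; case: ifP => _; last by lia.
by rewrite esize_cons; have := esize_item_tgt a; lia.
Qed.

Lemma ptime_leaves_to_root : ptime (fun p : seq item_encType * seq bool =>
  leaves_to_root bits_eq item_src item_tgt p.1 inG p.2).
Proof.
have pv := ptime_visit.
apply: (@ptime_foldr_incr _ _ _ (fun (p : seq item_encType * seq bool) (_ : item_encType) L =>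
  visit bits_eq item_src item_tgt p.1 inG L) (fun p => [:: p.2]) (fun p => p.1) _ _ _ id).
- by ptime_auto.
- by ptime_auto.
- apply: (ptime_comp (f := fun p : seq item_encType * seq bool * item_encType * seq (seq bool)
    => (p.1.1.1, p.2)) _ pv); by ptime_auto.
- by poly_bounded.
by move=> [l r] a L; rewrite esize_pair /=; apply: leq_trans (esize_visit l L) _; lia.
Qed.

(** Each new vector has one bit per arc whatever the preceding one is, so every exchange adds a
    bounded amount. *)
Lemma ptime_bits_exchanges :
  ptime (fun p : seq item_encType * (seq (seq bool) * seq bool) =>
    bits_exchanges p.1 inG (improves bits_eq item_tgt p.1 inS inG cmp) p.2.1 p.2.2).
Proof.
have p2 := ptime_item_tgt.
apply: (@ptime_foldr_incr _ _ _ (fun (p : seq item_encType * (seq (seq bool) * seq bool))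
    (v : seq bool) (Ts : seq (seq bool)) =>
  if improves bits_eq item_tgt p.1 inS inG cmp v
  then bits_redirect p.1 inG v (head [::] Ts) :: Ts else Ts)
  (fun p => [:: p.2.2]) (fun p => p.2.1) _ _ _ (fun n => 4 * n + 2)).
- by ptime_auto.
- by ptime_auto.
- by rewrite /improves /bits_redirect; ptime_auto.
- by poly_bounded.
move=> [l [L cur]] v Ts /=; case: ifP => _; last by lia.
set B := bits_redirect _ _ _ _; rewrite !esize_pair esize_cons.
have : esize (B : seq bool) <= (4 * size l).+1.
  by apply: leq_trans (esize_bits B) _; rewrite size_map size_pair_bits.
by have := size_leq_esize (l : seq item_encType); lia.
Qed.

Lemma ptime_bits_phase : ptime (fun p : seq item_encType * (seq bool * seq bool) =>
  bits_phase p.1 inS inG cmp p.2.1 p.2.2).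
Proof.
apply: (ptime_comp (f := fun p : seq item_encType * (seq bool * seq bool) => (p.1,
   (leaves_to_root bits_eq item_src item_tgt p.1 inG p.2.1, p.2.2))) _ ptime_bits_exchanges).
apply: ptime_pair; first by ptime_auto.
apply: ptime_pair; last by ptime_auto.
apply: (ptime_comp (f := fun p : seq item_encType * (seq bool * seq bool) => (p.1, p.2.1))
  _ ptime_leaves_to_root); by ptime_auto.
Qed.

End PtimePhase.

Lemma ptime_bits_reconfiguration : ptime bits_reconfiguration.
Proof.
have p1 : ptime (X := item_encType) in_fst by rewrite /in_fst; ptime_auto.
have p2 : ptime (X := item_encType) in_snd by rewrite /in_snd; ptime_auto.
have plt := ptime_item_lt.
have pge : ptime (X := prod_encType item_encType item_encType)
  (fun p => ~~ item_lt p.2 p.1) by ptime_auto.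
apply: ptime_cat; first apply: ptime_rev; last apply: ptime_behead.
- by apply: (ptime_comp (f := fun x => (pair_bits (pair_bits x.2.1 x.2.2.2.1) x.2.2.2.2,
    (x.2.2.1, x.2.2.2.1))) _ (ptime_bits_phase p1 p2 plt)); ptime_auto.
- by apply: (ptime_comp (f := fun x => (pair_bits (pair_bits x.2.1 x.2.2.2.1) x.2.2.2.2,
    (x.2.2.1, x.2.2.2.2))) _ (ptime_bits_phase p2 p1 pge)); ptime_auto.
Qed.

Definition nat_bits n := if bin_of_nat n is BinNums.Npos p then bits_of_pos p else [::].

Lemma nat_bitsK n : bits_val (nat_bits n) = n.
Proof.
rewrite -[RHS]bin_of_natK /nat_bits; case: (bin_of_nat n) => // p.
exact: bits_val_of_pos.
Qed.

(** The encoding drops the sign of the numerator; nonnegativity makes the absolute values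
    lossless. *)
Lemma rat_lt_cross (p q : rat) : (0 <= p)%R -> (0 <= q)%R ->
  (`|numq p| * `|denq q| < `|numq q| * `|denq p|)%N = (p < q)%R.
Proof.
move=> p0 q0; rewrite -[in RHS](divq_num_den p) -[in RHS](divq_num_den q).
rewrite ltr_pdivrMr ?ltr0z ?denq_gt0 // mulrAC ltr_pdivlMr ?ltr0z ?denq_gt0 //.
rewrite -!intrM ltr_int.
rewrite -[in RHS](gez0_abs (_ : 0 <= numq p)%R) ?numq_ge0 //.
rewrite -[in RHS](gez0_abs (_ : 0 <= numq q)%R) ?numq_ge0 //.
rewrite -[in RHS](gtz0_abs (denq_gt0 p)) -[in RHS](gtz0_abs (denq_gt0 q)).
by rewrite -!PoszM ltz_nat.
Qed.

Lemma enc_map (A : Type) (X : encType) (f : A -> X) s :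
  enc (map f s) = enc_seq (fun a => enc (f a)) s.
Proof. by elim: s => //= a s IH; rewrite -IH. Qed.

(** * Agreement of the bit-string algorithm with the one on digraphs *)

Section Encoding.
Variables (D : digraph) (lambda : arcs D -> rat) (r : vertices D).
Variables T1 T2 : {set arcs D}.
Hypothesis lambda_ge0 : forall a, (0 <= lambda a)%R.

Definition vertex_bits (v : vertices D) := nat_bits (enum_rank v).

Definition arc_bits (a : arcs D) :=
  (vertex_bits (source a), (vertex_bits (target a),
    (nat_bits `|numq (lambda a)|, nat_bits `|denq (lambda a)|))).

Definition arc_item (a : arcs D) : item := (arc_bits a, a \in T1, a \in T2).

Definition set_bits (T : {set arcs D}) := [seq a \in T | a <- enum (arcs D)].

Definition instance_bits :=
  (map vertex_bits (enum (vertices D)), (map arc_bits (enum (arcs D)),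
    (vertex_bits r, (set_bits T1, set_bits T2)))).

Lemma enc_instanceE : enc_instance lambda r T1 T2 = enc instance_bits.
Proof.
rewrite -[RHS]/(Node (enc (map vertex_bits (enum (vertices D))))
  (Node (enc (map arc_bits (enum (arcs D)))) (Node (enc (vertex_bits r))
  (Node (enc (set_bits T1)) (enc (set_bits T2)))))).
by rewrite !enc_map.
Qed.

Lemma enc_reconfigurationE Ts : enc_reconfiguration Ts = enc (map set_bits Ts).
Proof.
rewrite /enc_reconfiguration enc_map; elim: Ts => //= T Ts ->.
by rewrite enc_map.
Qed.

Lemma vertex_bits_eq u v : bits_eq (vertex_bits u) (vertex_bits v) = (u == v).
Proof. by rewrite bits_eqE !nat_bitsK (inj_eq val_inj) (inj_eq enum_rank_inj). Qed.

Lemma arc_item_lt a b : item_lt (arc_item a) (arc_item b) = (lambda a < lambda b)%R.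
Proof. by rewrite /item_lt bits_ltE !bits_mulE !nat_bitsK rat_lt_cross. Qed.

Lemma bits_exchanges_map (S G : {set arcs D}) inG c c' L :
  (forall a, inG (arc_item a) = (a \in G)) ->
  (forall v, c' (vertex_bits v) = c v) ->
  bits_exchanges (map arc_item (enum (arcs D))) inG c' (map vertex_bits L) (set_bits S)
  = map set_bits (exchanges S G c L).
Proof.
move=> inGE cE; rewrite /bits_exchanges foldr_map; elim: L => //= v L ->.
rewrite cE; case: ifP => // _ /=; congr (_ :: _).
(* The list is nonempty, so the different defaults of [head] on the two sides do not matter. *)
have [T [Ts ->]] : exists T Ts, exchanges S G c L = T :: Ts.
  by have := size_exchanges S G c L; case: exchanges => // T Ts _; exists T, Ts.
rewrite /bits_redirect pair_bits_map -map_comp; apply: eq_map => a /=.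
by rewrite [item_tgt _]/(vertex_bits (target a)) vertex_bits_eq inGE inE; case: ifP.
Qed.

Lemma bits_phase_map (S G : {set arcs D}) inS inG cmp cmp' :
  (forall a, inS (arc_item a) = (a \in S)) ->
  (forall a, inG (arc_item a) = (a \in G)) ->
  (forall a b, cmp' (arc_item a) (arc_item b) = cmp a b) ->
  bits_phase (map arc_item (enum (arcs D))) inS inG cmp' (vertex_bits r) (set_bits S)
  = map set_bits (exchanges S G (graph_improves S G cmp) (graph_order G r)).
Proof.
move=> inSE inGE cmpE; rewrite /bits_phase.
rewrite (@leaves_to_root_map _ _ _ _ eq_op bits_eq (@source D) (@target D) item_src
  item_tgt arc_item vertex_bits vertex_bits_eq _ _ _ (fun a => a \in G)) //.
apply: bits_exchanges_map => // v.
by rewrite (@improves_map _ _ _ _ eq_op bits_eq (@target D) item_tgt arc_item vertex_bits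
  vertex_bits_eq _ _ (fun a => a \in S) (fun a => a \in G) cmp).
Qed.

Lemma bits_reconfigurationE :
  bits_reconfiguration instance_bits = map set_bits (reconfiguration lambda r T1 T2).
Proof.
rewrite /bits_reconfiguration /= !pair_bits_map.
rewrite (bits_phase_map (S := T1) (G := T2) (cmp := fun a b => (lambda a < lambda b)%R)) //;
  last exact: arc_item_lt.
rewrite (bits_phase_map (S := T2) (G := T1) (cmp := fun a b => ~~ (lambda b < lambda a)%R)) //;
  last by move=> a b; rewrite arc_item_lt.
by rewrite /reconfiguration map_cat map_rev behead_map.
Qed.

End Encoding.

(** Any real domain is allowed, to cover the real labels of the first claim and the rational ones of
    the second. *)
Lemma reconfiguration_exists (R : realDomainType) (D : digraph) (lambda : arcs D -> R)
    (r : vertices D) (T1 T2 : {set arcs D}) :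
  (forall a, (0 <= lambda a)%R) ->
  is_tr_arborescence lambda r T1 -> is_tr_arborescence lambda r T2 ->
  let Ts := reconfiguration lambda r T1 T2 in
  [/\ reconfiguration_seq T1 T2 Ts,
      forall T, T \in Ts -> is_tr_arborescence lambda r T
    & reconfiguration_length Ts = #|T1 :\: T2|].
Proof.
move=> lambda_ge0 /tr_arborescence_ranked[d1 rk1 d1_le].
move=> /tr_arborescence_ranked[d2 rk2 d2_le].
exact: (reconfigurationP lambda_ge0 rk1 rk2 d1_le d2_le).
Qed.

Theorem theorem1 :
  (forall (R : realType) (D : digraph) (lambda : arcs D -> R) (r : vertices D)
     (T1 T2 : {set arcs D}),
     (forall a, (0 <= lambda a)%R) ->
     is_tr_arborescence lambda r T1 ->
     is_tr_arborescence lambda r T2 ->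
     exists Ts : seq {set arcs D},
       [/\ reconfiguration_seq T1 T2 Ts,
           forall T, T \in Ts -> is_tr_arborescence lambda r T
         & reconfiguration_length Ts = #|T1 :\: T2|])
  /\
  (exists (P : program) (p : {poly nat}),
     forall (D : digraph) (lambda : arcs D -> rat) (r : vertices D)
       (T1 T2 : {set arcs D}),
       (forall a, (0 <= lambda a)%R) ->
       is_tr_arborescence lambda r T1 ->
       is_tr_arborescence lambda r T2 ->
       exists (Ts : seq {set arcs D}) (c : nat),
         [/\ run P (enc_instance lambda r T1 T2) (enc_reconfiguration Ts) c,
             (c <= p.[tree_size (enc_instance lambda r T1 T2)]%R)%N,
             reconfiguration_seq T1 T2 Ts,
             forall T, T \in Ts -> is_tr_arborescence lambda r T
           & reconfiguration_length Ts = #|T1 :\: T2|]).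
Proof.
split=> [R D lambda r T1 T2 lambda_ge0 tr1 tr2|].
  by exists (reconfiguration lambda r T1 T2); exact: reconfiguration_exists.
have [e [ds [h [[k h_le] _ implements]]]] := ptime_bits_reconfiguration.
(* The entry point occupies address 0, so the auxiliary functions start at address 1; the polynomial
   takes the value [n.+2 ^ k] at [n]. *)
exists (e 1 :: ds 1), (('X + 2%:P) ^+ k)%R => D lambda r T1 T2 lambda_ge0 tr1 tr2.
have [|c run_c c_le] := implements (e 1 :: ds 1) 1 _ (instance_bits lambda r T1 T2) [::].
  by move=> i.
have [seqT trT lenT] := reconfiguration_exists lambda_ge0 tr1 tr2.
exists (reconfiguration lambda r T1 T2), c; split=> //.
  by rewrite /run enc_instanceE enc_reconfigurationE -bits_reconfigurationE.
rewrite enc_instanceE; apply: leq_trans c_le (leq_trans (h_le _) _).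
by rewrite horner_exp hornerD hornerX hornerC natrXE natrDE addn2.
Qed.
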